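(* Consider the affine flag variety $\mathrm{SL}_2((t))/I$ of $\mathrm{SL}_2$ over $\mathbb{C}$, the subgroup $I_4$ of $I$, the semidirect product $I_4^{\mathrm{rot}} = I_4\rtimes \mathbb{G}_m^{\mathrm{rot}}$ with loop rotations, and the subsets $E_n^{\mathrm{o}},E_n^{\mathrm{h}},O_n^{\mathrm{o}},O_n^{\mathrm{h}},E_n^{\mathrm{ho}},E_n^{\mathrm{hh}},O_n^{\mathrm{ho}},O_n^{\mathrm{hh}}$ of $\mathrm{SL}_2((t))/I$, all as given in the context. Then: (1) For $n<0$, each of $E_n^{\mathrm{o}}$ and $E_n^{\mathrm{h}}$ is an $I_4$-orbit. (2) $O_n^{\mathrm{o}}$ for $n\leq 0$, and $O_n^{\mathrm{h}}$ for $n\leq -2$, is an $I_4$-orbit. (3) $E_n^{\mathrm{ho}}$ for $n>0$, and $E_n^{\mathrm{hh}}$ for $n\geq 2$, is an $I_4$-orbit. (4) For $n>0$, each of $O_n^{\mathrm{ho}}$ and $O_n^{\mathrm{hh}}$ is an $I_4$-orbit. (5) For $n>0$, $E_n^{\mathrm{o}}$ decomposes (as a disjoint union) into the $I_4^{\mathrm{rot}}$-orbit $$E_n^{\mathrm{oo}} := [n, \mathbb{C}^{\times}t^{-n}+\mathbb{C}^{\times}t^{-n+1}+\mathbb{C} t^{-n+2}+\dots + \mathbb{C} t^{n-1}] \cong \mathbb{G}_m^2 \times \mathbb{A}^{2n-2}$$ and the $I_4$-orbit $$E_n^{\mathrm{oh}} := [n, \mathbb{C}^{\times}t^{-n}+\mathbb{C}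 t^{-n+2}+\dots + \mathbb{C} t^{n-1}] \cong \mathbb{G}_m \times \mathbb{A}^{2n-2}.$$ (6) For $n>0$, $O_n^{\mathrm{o}}$ decomposes (as a disjoint union) into the $I_4^{\mathrm{rot}}$-orbit $$O_n^{\mathrm{oo}} := [n, \mathbb{C}^{\times}t^{-n}+\mathbb{C}^{\times}t^{-n+1}+\mathbb{C} t^{-n+2}+\dots + \mathbb{C} t^n]' \cong \mathbb{G}_m^2 \times \mathbb{A}^{2n-1}$$ and the $I_4$-orbit $$O_n^{\mathrm{oh}} := [n, \mathbb{C}^{\times}t^{-n}+\mathbb{C} t^{-n+2}+\dots + \mathbb{C} t^n]' \cong \mathbb{G}_m \times \mathbb{A}^{2n-1}.$$
   Context: Everything is over $\mathbb{C}$, and only $\mathbb{C}$-points are considered. $\mathrm{SL}_2((t))$ is the group of $2\times 2$ matrices with entries in $\mathbb{C}((t))$ and determinant $1$. The standard Iwahori subgroup is $$I = \left\{\begin{pmatrix} a & b \\ tc & d\end{pmatrix} : a,b,c,d \in \mathbb{C}[[t]],\ ad-tbc = 1\right\}.$$ The quotient $\mathrm{SL}_2((t))/I$ is the affine flag variety (an ind-variety); $\mathrm{SL}_2((t))$ and its subgroups act on it by left multiplication. The following is a subgroup of $I$: $$I_4 = \left\{\begin{pmatrix} \alpha(1+t^2a) & t^2b \\ t^2c & \alpha^{-1}(1+t^2d)\end{pmatrix} : \alpha \in \mathbb{C}^{\times},\ a, b, c, d \in \mathbb{C}[[t]],\ a+d+t^2(ad-bc)=0\right\}.$$ For $n\in\mathbb{Z}$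 and $p\in\mathbb{C}[t,t^{-1}]$ that is $0$ or of degree (largest exponent) $<n$, write $[n,p]$ for the coset $\begin{pmatrix} t^n & p \\ 0 & t^{-n}\end{pmatrix}I$. For $n\in\mathbb{Z}$ and $p\in\mathbb{C}[t,t^{-1}]$ that is $0$ or of degree $\le n$, write $[n,p]'$ for the coset $\begin{pmatrix} p & t^n \\ -t^{-n} & 0\end{pmatrix}I$. Every element of $\mathrm{SL}_2((t))/I$ is of exactly one of these two forms, for unique $n$ and $p$. The group $\mathbb{G}_m^{\mathrm{rot}}=\mathbb{C}^\times$ acts on $\mathrm{SL}_2((t))$ by loop rotation $t\mapsto\gamma t$, $\gamma\in\mathbb{C}^\times$ (substitution in all matrix entries). This preserves $I$ and $I_4$ and hence induces an action on $\mathrm{SL}_2((t))/I$, given by $\gamma\cdot[n,p(t)]=[n,\gamma^n p(\gamma t)]$ and $\gamma\cdot[n,p(t)]'=[n,\gamma^n p(\gamma t)]'$. The semidirect product $I_4^{\mathrm{rot}} = I_4\rtimes \mathbb{G}_m^{\mathrm{rot}}$ acts on $\mathrm{SL}_2((t))/I$ through the left multiplication action of $I_4$ and this action of $\mathbb{G}_m^{\mathrm{rot}}$. For a set $S$ of Laurent polynomials, $[n,S]=\{[n,p]:p\in S\}$ and $[n,S]'=\{[n,p]':p\in S\}$. A sum of terms of the form $\mathbb{C}t^m$ or $\mathbb{C}^\times t^m$ (for distinct exponents $m$) denotes the set of all Laurent polynomials whose coefficient of $t^m$ is arbitrary for a term $\mathbb{C}t^m$, is nonzero for a term $\mathbb{C}^\times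 t^m$, and is zero for exponents that do not occur; a range $\mathbb{C}t^i+\dots+\mathbb{C}t^j$ with $j<i$ contributes no terms (it is $\{0\}$). An empty union is empty. $\mathbb{A}^d$ is affine $d$-space and $\mathbb{G}_m=\mathbb{A}^1\setminus\{0\}$. Definitions of the subsets: For $n>0$: $E_n^{\mathrm{o}} := [n, \mathbb{C}^{\times} t^{-n}+\mathbb{C} t^{-n+1}+\dots + \mathbb{C} t^{n-1}]$, $E_n^{\mathrm{ho}} := [n, \mathbb{C}^{\times}t^{-n+1}+\mathbb{C} t^{-n+2}+\dots + \mathbb{C} t^{n-1}]$, $E_n^{\mathrm{hh}} := [n, \mathbb{C} t^{-n+2}+\dots+\mathbb{C} t^{n-1}]$. For $n\ge 0$: $O_n^{\mathrm{o}} := [n,\mathbb{C}^{\times} t^{-n}+\mathbb{C} t^{-n+1}+\dots + \mathbb{C} t^n]'$. For $n>0$: $O_n^{\mathrm{ho}} := [n, \mathbb{C}^{\times}t^{-n+1}+\mathbb{C} t^{-n+2}+\dots + \mathbb{C} t^n]'$, $O_n^{\mathrm{hh}} := [n, \mathbb{C} t^{-n+2}+\dots + \mathbb{C} t^n]'$. For $n<0$: $E_n^{\mathrm{o}} := [-n-1, \mathbb{C}^{\times}t^n+\mathbb{C} t^{n+1}+\dots +\mathbb{C} t^{-n-1}]'$ and $$E_n^{\mathrm{h}} := \Big(\bigsqcup_{k=1}^{-2n-1}[-n-1-k,\ \mathbb{C}^{\times} t^n + \mathbb{C} t^{n+1}+\dots + \mathbb{C} t^{-n-1-k}]'\Big)\sqcup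 \{[n,0]\}.$$ For $n<0$: $O_n^{\mathrm{o}} := [-n-1, \mathbb{C}^{\times}t^n+\mathbb{C} t^{n+1}+\dots+\mathbb{C} t^{-n-2}]$ and $$O_n^{\mathrm{h}} := \Big(\bigsqcup_{k=1}^{-2n-2}[-n-1-k,\ \mathbb{C}^{\times}t^n +\mathbb{C} t^{n+1}+\dots + \mathbb{C} t^{-n-2-k}]\Big)\sqcup \{[n,0]'\}.$$ *)

(* Defs.v *)
From HB Require Import structures.
From mathcomp Require Import all_boot all_order all_algebra.
From mathcomp Require Import complex.
From mathcomp Require Import all_classical all_reals.

Set Implicit Arguments.
Unset Strict Implicit.
Unset Printing Implicit Defensive.

Import Order.TTheory GRing.Theory Num.Theory.

Local Open Scope classical_set_scope.
Local Open Scope ring_scope.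

(* Formal Laurent series: coefficient functions on int that vanish below some
   bound, with the convolution product. *)

Record laurent (K : nzRingType) := Laurent {
  lcoef : int -> K;
  lcoef_bounded : exists N : nat, forall k : int, k < - N%:Z -> lcoef k = 0 }.

HB.instance Definition _ (K : nzRingType) := gen_eqMixin (laurent K).
HB.instance Definition _ (K : nzRingType) := gen_choiceMixin (laurent K).

Section LaurentRing.
Variable K : comNzRingType.
Implicit Types (f g h : laurent K) (a b m n : nat) (k : int).

Definition lbelow f a := forall k, k < - a%:Z -> lcoef f k = 0.

Lemma laurentP f g : lcoef f =1 lcoef g -> f = g.
Proof.
case: f g => [f fb] [g gb] /= /funext fg; rewrite fg in fb *.
by congr Laurent; exact: Prop_irrelevance.
Qed.

Lemma lbelowW f a b : (a <= b)%N -> lbelow f a -> lbelow f b.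
Proof.
by move=> ab fa k kb; apply: fa; apply: lt_le_trans kb _; rewrite lerN2.
Qed.

Fact lzero_bounded : exists N : nat, forall k : int, k < - N%:Z -> 0 = 0 :> K.
Proof. by exists 0%N. Qed.

Definition lzero := Laurent lzero_bounded.

Fact ladd_bounded f g : exists N : nat, forall k : int,
  k < - N%:Z -> lcoef f k + lcoef g k = 0.
Proof.
have [[a fa] [b gb]] := (lcoef_bounded f, lcoef_bounded g).
exists (maxn a b) => k kN.
rewrite (lbelowW (leq_maxl a b) fa kN) (lbelowW (leq_maxr a b) gb kN).
exact: addr0.
Qed.

Definition ladd f g := Laurent (ladd_bounded f g).

Fact lopp_bounded f : exists N : nat, forall k : int,
  k < - N%:Z -> - lcoef f k = 0.
Proof.
by have [a fa] := lcoef_bounded f; exists a => k /fa ->; rewrite oppr0.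
Qed.

Definition lopp f := Laurent (lopp_bounded f).

Fact laddA : associative ladd.
Proof. by move=> f g h; apply: laurentP => k /=; rewrite addrA. Qed.

Fact laddC : commutative ladd.
Proof. by move=> f g; apply: laurentP => k /=; rewrite addrC. Qed.

Fact ladd0 : left_id lzero ladd.
Proof. by move=> f; apply: laurentP => k /=; rewrite add0r. Qed.

Fact laddN : left_inverse lzero lopp ladd.
Proof. by move=> f; apply: laurentP => k /=; rewrite addNr. Qed.

HB.instance Definition _ :=
  GRing.isZmodule.Build (laurent K) laddA laddC ladd0 laddN.

(* Only finitely many terms of the sum are nonzero. *)
Definition lmul_coef f g k : K :=
  \sum_(i \in [set: int]) (lcoef f i * lcoef g (k - i)).

Fact lmul_coefE f g a b k n : lbelow f a -> lbelow g b ->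
  k + a%:Z + b%:Z < n%:Z ->
  lmul_coef f g k =
    \sum_(i < n) lcoef f (i%:Z - a%:Z) * lcoef g (k + a%:Z - i%:Z).
Proof.
move=> fa gb kn; rewrite /lmul_coef.
pose s : seq int := [seq i%:Z - a%:Z | i <- iota 0 n].
have us : uniq s.
  by rewrite map_inj_uniq ?iota_uniq// => i j /addIr[].
rewrite -(fsbig_widen [set` s]) //=; last first.
  move=> i [_ si] /=.
  have [ia|ia] := ltP i (- a%:Z); first by rewrite [X in X * _]fa ?mul0r//.
  rewrite [X in _ * X]gb ?mulr0//.
  rewrite ltNge; apply/negP => ki; apply: si; apply/mapP.
  have ia0 : 0 <= i + a%:Z by rewrite -lerBlDr sub0r.
  exists (absz (i + a%:Z)); last by rewrite gez0_abs// addrK.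
  rewrite mem_iota add0n /= -ltz_nat gez0_abs//.
  apply: le_lt_trans kn; rewrite lerBrDr addrC -lerBrDr opprK in ki.
  by rewrite (addrAC k) lerD2r.
rewrite -fsbig_seq//= /s big_map.
have -> : iota 0 n = index_iota 0 n by rewrite /index_iota subn0.
rewrite big_mkord.
by apply: eq_bigr => i _; rewrite opprB addrA (addrAC k).
Qed.

Fact lmul_coef_below f g a b k : lbelow f a -> lbelow g b ->
  k < - (a + b)%N%:Z -> lmul_coef f g k = 0.
Proof.
move=> fa gb kab; rewrite (@lmul_coefE f g a b k 0) ?big_ord0//.
by rewrite -addrA -PoszD -ltrBrDr sub0r.
Qed.

Fact lmul_bounded f g : exists N : nat, forall k : int,
  k < - N%:Z -> lmul_coef f g k = 0.
Proof.
have [[a fa] [b gb]] := (lcoef_bounded f, lcoef_bounded g).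
by exists (a + b)%N => k; exact: lmul_coef_below.
Qed.

Definition lmul f g := Laurent (lmul_bounded f g).

Fact lone_bounded : exists N : nat, forall k : int,
  k < - N%:Z -> (k == 0)%:R = 0 :> K.
Proof. by exists 0%N => k; rewrite oppr0 => /lt_eqF ->. Qed.

Definition lone := Laurent lone_bounded.

(* The ring laws are transported from {poly K} through truncation. *)
Let tr f a n : {poly K} := \poly_(i < n) lcoef f (i%:Z - a%:Z).

Let coef_tr f a n m : (m < n)%N -> (tr f a n)`_m = lcoef f (m%:Z - a%:Z).
Proof. by move=> mn; rewrite coef_poly mn. Qed.

Let lmul_tr f g a b n m : lbelow f a -> lbelow g b -> (m < n)%N ->
  lcoef (lmul f g) (m%:Z - (a + b)%N%:Z) = (tr f a n * tr g b n)`_m.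
Proof.
move=> fa gb mn; rewrite /= (@lmul_coefE f g a b _ m.+1)//; last first.
  by rewrite -addrA -PoszD subrK ltz_nat.
rewrite coefM; apply: eq_bigr => i _.
have im : (i <= m)%N by rewrite -ltnS.
rewrite !coef_tr ?(leq_ltn_trans im)//; last first.
  by rewrite (leq_ltn_trans (leq_subr _ _)).
congr (_ * lcoef g _); rewrite -subzn// PoszD opprD addrA.
by rewrite addrAC addrNK addrAC.
Qed.

Let below_mul f g a b : lbelow f a -> lbelow g b -> lbelow (lmul f g) (a + b).
Proof. by move=> fa gb k; exact: lmul_coef_below. Qed.

Let laurent_eq f g a : lbelow f a -> lbelow g a ->
  (forall m, lcoef f (m%:Z - a%:Z) = lcoef g (m%:Z - a%:Z)) -> f = g.
Proof.
move=> fa ga fg; apply: laurentP => k.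
have [ka|ka] := ltP k (- a%:Z); first by rewrite fa// ga.
have ka0 : 0 <= k + a%:Z by rewrite -lerBlDr sub0r.
by have := fg (absz (k + a%:Z)); rewrite gez0_abs// addrK.
Qed.

Fact lmulC : commutative lmul.
Proof.
move=> f g; have [[a fa] [b gb]] := (lcoef_bounded f, lcoef_bounded g).
apply: (@laurent_eq _ _ (a + b)); [exact: below_mul| |].
  by rewrite addnC; exact: below_mul.
move=> m; rewrite (lmul_tr fa gb (ltnSn m)) mulrC.
by rewrite -(lmul_tr gb fa (ltnSn m)) addnC.
Qed.

Fact lmulA : associative lmul.
Proof.
move=> f g h; have [a fa] := lcoef_bounded f.
have [[b gb] [c hc]] := (lcoef_bounded g, lcoef_bounded h).
apply: (@laurent_eq _ _ (a + b + c)).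
- by rewrite -addnA; exact: below_mul (below_mul _ _).
- exact: below_mul (below_mul _ _) _.
move=> m; have mS := ltnSn m.
rewrite (lmul_tr (below_mul fa gb) hc mS) -addnA.
rewrite (lmul_tr fa (below_mul gb hc) mS).
transitivity ((tr f a m.+1 * tr g b m.+1 * tr h c m.+1)`_m).
  rewrite -mulrA !coefM; apply: eq_bigr => i _; congr (_ * _).
  have im : (m - i < m.+1)%N by rewrite ltnS leq_subr.
  by rewrite coef_tr// (lmul_tr gb hc im).
rewrite [in LHS]coefM [in RHS]coefM; apply: eq_bigr => i _; congr (_ * _).
by rewrite coef_tr// (lmul_tr fa gb (ltn_ord i)).
Qed.

Fact lmul1 : left_id lone lmul.
Proof.
move=> f; have [a fa] := lcoef_bounded f.
have b1 : lbelow lone 0 by move=> k /=; rewrite oppr0 => /lt_eqF ->.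
apply: (@laurent_eq _ _ (0 + a)) => [||m].
- exact: below_mul.
- exact: fa.
rewrite (lmul_tr b1 fa (ltnSn m)).
have -> : tr lone 0 m.+1 = 1.
  apply/polyP => i; rewrite coef_poly coef1 /= subr0.
  by case: ltnP => //; case: i.
by rewrite mul1r coef_tr.
Qed.

Fact lmulDl : left_distributive lmul +%R.
Proof.
move=> f g h; have [a fa] := lcoef_bounded f.
have [[b gb] [c hc]] := (lcoef_bounded g, lcoef_bounded h).
pose d := maxn a b.
have fd : lbelow f d := lbelowW (leq_maxl a b) fa.
have gd : lbelow g d := lbelowW (leq_maxr a b) gb.
have fgd : lbelow (f + g) d by move=> k kd; rewrite /= fd// gd// addr0.
apply: (@laurent_eq _ _ (d + c)) => [||m].
- exact: below_mul.
- move=> k kd; rewrite /= (lmul_coef_below fd hc kd).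
  by rewrite (lmul_coef_below gd hc kd) addr0.
have mS := ltnSn m; set k := m%:Z - _.
change (lcoef (lmul (f + g) h) k = lcoef (lmul f h) k + lcoef (lmul g h) k).
rewrite {}/k.
rewrite (lmul_tr fgd hc mS).
have -> : tr (f + g) d m.+1 = tr f d m.+1 + tr g d m.+1.
  by apply/polyP => i; rewrite coefD !coef_poly; case: ifP; rewrite ?addr0.
by rewrite mulrDl coefD -(lmul_tr fd hc mS) -(lmul_tr gd hc mS).
Qed.

Fact lone_neq0 : lone != 0.
Proof.
apply/eqP => /(congr1 (fun f => lcoef f 0)) /= /eqP.
by rewrite oner_eq0.
Qed.

HB.instance Definition _ := GRing.Zmodule_isComNzRing.Build (laurent K)
  lmulA lmulC lmul1 lmulDl lone_neq0.

End LaurentRing.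

Section LaurentPoly.
Variable K : fieldType.
Implicit Types (f : laurent K) (c : K) (m : int).

Fact lmonom_bounded c m : exists N : nat, forall k : int,
  k < - N%:Z -> (if k == m then c else 0) = 0.
Proof.
exists (absz m) => k; case: eqP => // -> mm.
by have := lt_le_trans mm (lerNnormlW (lexx `|m|)); rewrite ltxx.
Qed.

(* c t^m *)
Definition lmonom c m : laurent K := Laurent (lmonom_bounded c m).

Definition tpow m : laurent K := lmonom 1 m.

Definition lconst c : laurent K := lmonom c 0.

Definition power_series : set (laurent K) :=
  [set f | forall k, k < 0 -> lcoef f k = 0].

(* The Laurent polynomials with nonzero coefficients at the exponents in U,
   arbitrary coefficients at those in V, and no other terms (U and V are always
   finite and disjoint below). *)
Definition lpols (U V : set int) : set (laurent K) :=
  [set p | (forall m, U m -> lcoef p m != 0) /\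
           (forall m, ~ U m -> ~ V m -> lcoef p m = 0)].

Fact lrot_bounded c f : exists N : nat, forall k : int,
  k < - N%:Z -> c ^ k * lcoef f k = 0.
Proof.
by have [a fa] := lcoef_bounded f; exists a => k /fa ->; rewrite mulr0.
Qed.

(* f(t) |-> f(ct) *)
Definition lrot c f : laurent K := Laurent (lrot_bounded c f).

End LaurentPoly.

Definition zrange (i j : int) : set int := [set m | i <= m <= j].

Definition mx2 (A : Type) (a b c d : A) : 'M[A]_2 :=
  \matrix_(i, j) if i == 0 then (if j == 0 then a else b)
                 else (if j == 0 then c else d).

(* Regular functions on a set of points T with coordinate functions x; J may be
   infinite. *)
Section RegularFunctions.
Variables (K : fieldType) (T J : Type) (x : J -> T -> K).

Inductive polyfun : (T -> K) -> Prop :=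
| polyfun_cst c : polyfun (fun=> c)
| polyfun_coord j : polyfun (x j)
| polyfun_add P Q : polyfun P -> polyfun Q -> polyfun (fun a => P a + Q a)
| polyfun_mul P Q : polyfun P -> polyfun Q -> polyfun (fun a => P a * Q a).

Definition regular_on (X : set T) (f : T -> K) :=
  forall a, X a -> exists P Q, [/\ polyfun P, polyfun Q, Q a != 0 &
    forall b, X b -> Q b != 0 -> f b = P b / Q b].

End RegularFunctions.

Section AffineFlagVariety.
Variable R : realType.
Local Notation C := R[i].
Local Notation L := (laurent C).
Local Notation M := 'M[L]_2.
Implicit Types (g h : M) (n : int) (p : L) (X : set M) (S Z : set (set M)).

Definition SL2 : set M := [set g | \det g = 1].

Definition iwahori : set M :=
  [set g | exists a b c d, [/\ [/\ power_series a, power_series b,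
      power_series c & power_series d],
      a * d - tpow C 1 * b * c = 1 & g = mx2 a b (tpow C 1 * c) d]].

Definition I4 : set M :=
  [set g | exists (alpha : C) (a b c d : L), [/\ alpha != 0,
      [/\ power_series a, power_series b, power_series c & power_series d],
      a + d + tpow C 2 * (a * d - b * c) = 0 &
      g = mx2 (lconst alpha * (1 + tpow C 2 * a)) (tpow C 2 * b)
              (tpow C 2 * c) (lconst alpha^-1 * (1 + tpow C 2 * d))]].

Definition coset g : set M := [set g *m h | h in iwahori].

(* SL_2((t))/I *)
Definition flag : set (set M) := coset @` SL2.

Definition lact g X : set M := [set g *m h | h in X].

Definition rot (c : C) X : set M := [set map_mx (lrot c) h | h in X].

Definition I4_orbit X : set (set M) := [set lact g X | g in I4].

(* The element (g, c) of I4 >< C^* acts as c followed by g. *)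
Definition I4rot_orbit X : set (set M) :=
  [set lact u.1 (rot u.2 X) | u in I4 `*` [set c | c != 0]].

Definition is_I4_orbit S := exists2 X, flag X & S = I4_orbit X.

Definition is_I4rot_orbit S := exists2 X, flag X & S = I4rot_orbit X.

(* The ind-variety structure of SL_2((t))/I, on C-points. SL_2((t)) is the union
   of the affine schemes of matrices with entries in t^-N C[[t]], whose
   coordinates are the coefficients of the entries. Since the projection to
   SL_2((t))/I is a Zariski-locally trivial I-torsor,
   - a subset of the quotient is closed iff its preimage is;
   - a function on a reduced locally closed subset is regular iff its pullback
     to the preimage is;
   - a map from a variety to the quotient is a morphism iff locally it lifts to
     a morphism to SL_2((t)). *)

Definition pole_le (N : nat) : set M := [set g | forall i j, lbelow (g i j) N].

Definition entry_coef (e : 'I_2 * 'I_2 * int) g : C :=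
  lcoef (g e.1.1 e.1.2) e.2.

Definition flag_closed Z := Z `<=` flag /\
  forall N, exists F : set (M -> C), F `<=` polyfun entry_coef /\
    forall g, SL2 g -> pole_le N g ->
      (Z (coset g) <-> forall f, F f -> f g = 0).

Definition flag_locally_closed S :=
  exists Z1 Z2, [/\ flag_closed Z1, flag_closed Z2 & S = Z1 `\` Z2].

Definition flag_regular S (f : set M -> C) := forall N,
  regular_on entry_coef (SL2 `&` pole_le N `&` coset @^-1` S) (f \o coset).

Definition row_coord m (j : 'I_m) (v : 'rV[C]_m) : C := v 0 j.

Definition flag_morphism m (V : set 'rV[C]_m) (phi : 'rV[C]_m -> set M) :=
  forall v, V v -> exists Q, [/\ polyfun (@row_coord m) Q, Q v != 0 &
    exists (G : 'rV[C]_m -> M) (N : nat),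
      (forall w, V w -> Q w != 0 ->
         [/\ SL2 (G w), pole_le N (G w) & phi w = coset (G w)]) /\
      (forall e, regular_on (@row_coord m) (V `&` [set w | Q w != 0])
                   (entry_coef e \o G))].

Definition flag_isomorphic S m (V : set 'rV[C]_m) :=
  flag_locally_closed S /\
  exists (phi : 'rV[C]_m -> set M) (psi : set M -> 'rV[C]_m),
    [/\ phi @` V = S, forall v, V v -> psi (phi v) = v, flag_morphism V phi &
        forall j, flag_regular S (fun X => row_coord j (psi X))].

(* Gm^a x A^b, as a subset of affine (a + b)-space *)
Definition Gm_affine (a b : nat) : set 'rV[C]_(a + b) :=
  [set v | forall i : 'I_a, v 0 (lshift b i) != 0].

Definition bracket n p : set M := coset (mx2 (tpow C n) p 0 (tpow C (- n))).

Definition bracket' n p : set M := coset (mx2 p (tpow C n) (- tpow C (- n)) 0).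

(* The value at n = 0 is irrelevant. *)
Definition E_o n : set (set M) :=
  if n < 0
  then bracket' (- n - 1) @` lpols [set n] (zrange (n + 1) (- n - 1))
  else bracket n @` lpols [set - n] (zrange (- n + 1) (n - 1)).

Definition E_ho n : set (set M) :=
  bracket n @` lpols [set - n + 1] (zrange (- n + 2) (n - 1)).

Definition E_hh n : set (set M) :=
  bracket n @` lpols set0 (zrange (- n + 2) (n - 1)).

Definition E_h n : set (set M) :=
  \bigcup_(k in zrange 1 (- 2 * n - 1))
    (bracket' (- n - 1 - k) @`
       lpols [set n] (zrange (n + 1) (- n - 1 - k)))
  `|` [set bracket n 0].

Definition E_oo n : set (set M) :=
  bracket n @` lpols [set - n; - n + 1] (zrange (- n + 2) (n - 1)).

Definition E_oh n : set (set M) :=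
  bracket n @` lpols [set - n] (zrange (- n + 2) (n - 1)).

Definition O_o n : set (set M) :=
  if n < 0
  then bracket (- n - 1) @` lpols [set n] (zrange (n + 1) (- n - 2))
  else bracket' n @` lpols [set - n] (zrange (- n + 1) n).

Definition O_ho n : set (set M) :=
  bracket' n @` lpols [set - n + 1] (zrange (- n + 2) n).

Definition O_hh n : set (set M) :=
  bracket' n @` lpols set0 (zrange (- n + 2) n).

Definition O_h n : set (set M) :=
  \bigcup_(k in zrange 1 (- 2 * n - 2))
    (bracket (- n - 1 - k) @`
       lpols [set n] (zrange (n + 1) (- n - 2 - k)))
  `|` [set bracket' n 0].

Definition O_oo n : set (set M) :=
  bracket' n @` lpols [set - n; - n + 1] (zrange (- n + 2) n).

Definition O_oh n : set (set M) :=
  bracket' n @` lpols [set - n] (zrange (- n + 2) n).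

End AffineFlagVariety.

Arguments E_o R n : clear implicits.
Arguments E_ho R n : clear implicits.
Arguments E_hh R n : clear implicits.
Arguments E_h R n : clear implicits.
Arguments E_oo R n : clear implicits.
Arguments E_oh R n : clear implicits.
Arguments O_o R n : clear implicits.
Arguments O_ho R n : clear implicits.
Arguments O_hh R n : clear implicits.
Arguments O_h R n : clear implicits.
Arguments O_oo R n : clear implicits.
Arguments O_oh R n : clear implicits.
Arguments Gm_affine R a b : clear implicits.

(* Main.v *)
Require Import Defs.
From mathcomp Require Import all_boot all_order all_algebra.
From mathcomp Require Import complex.
From mathcomp Require Import all_classical all_reals.
From mathcomp Require Import ring zify.
Import Order.TTheory GRing.Theory Num.Theory.
Local Open Scope classical_set_scope.
Local Open Scope ring_scope.

Set Implicit Arguments.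
Unset Strict Implicit.
Unset Printing Implicit Defensive.

(** Let [w] be a monomial matrix, [diag(t^n, t^-n)] or the antidiagonal matrix
    with entries [t^n] and [-t^-n]; its level is [m = 2n] or [m = 2n + 1].
    Then [w I w^-1] is the group of matrices of determinant 1 with diagonal
    entries in [C[[t]]], upper right entry in [t^m C[[t]]] and lower left entry
    in [t^(1-m) C[[t]]].  Hence, for unipotent matrices [U(x)] (upper) and
    [L(s)] (lower), the point [U(x) w I] determines exactly [x] mod [t^m] and
    [L(s) w I] determines exactly [s] mod [t^(1-m)].  Both families of brackets
    are of this form: [[n, p]] is [U(t^n p) w] and [[n, p]'] is [U(-t^n p) w],
    so the two families are treated together, indexed by a boolean.

    Positive index.  All the sets of the statement are cut out, among the
    [U(x) w I] with [x] a power series, by conditions on the two lowest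
    coefficients of [x].  An element of [I4] acts on [x] by the Moebius
    transformation [x |-> (A x + B) / (G x + D)], and modulo [t^2] it is
    diagonal, with entries [alpha] and [alpha^-1]: so the pair of lowest
    coefficients is multiplied by [alpha^2], while [B] in [t^2 C[[t]]] moves all
    the other coefficients at will ([I4_orbit_ucell]).  The orbits are thus the
    classes of pairs under scaling by squares, that is, by all of [C^*].  Loop
    rotation multiplies the second coefficient by an arbitrary scalar, which
    merges the classes where both coefficients are nonzero
    ([ucell_is_I4rot_orbit]).

    Negative index.  Here the lower unipotents are the right chart: for
    [s x = 1], [L(s)] equals [U(x)] times an antidiagonal matrix times [U(x)], so
    [L(s) w I = U(x) w' I] for another monomial matrix [w'] as long as [w]
    absorbs the last factor ([wpt_lmx_umx]).  Under [x = s^-1] the pieces of the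
    union defining [E_n^h] or [O_n^h] become the sets of all [s] of a given
    valuation, at least 2, and the extra point is [s = 0]; the whole union is
    the set of all [s] in [t^2 C[[t]]] ([lcell_hh]).  The same Moebius argument
    applies to [s] ([I4_orbit_lcell]).

    Isomorphisms.  Writing [g w^-1] as a matrix [k], the points [U(x) w I] with
    [x] a power series form the open part [k_11(0) <> 0] of a closed set defined
    by bounds on the orders of the entries of [k], and there [x] is the quotient
    [k_01 / k_11] mod [t^m] ([wpt_umxP]).  Its coefficients are therefore
    polynomials in the coefficients of [g] divided by powers of [k_11(0)]
    ([quo_coef_polyfun]), which gives both the local closedness of the sets and
    the regularity of the inverse of [x |-> U(x) w I]. *)

(** * Laurent series: order, leading coefficients, division *)

Section LaurentSeries.
Variable K : fieldType.
Implicit Types (f g x : laurent K) (a b k m n : int) (c : K).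

(** The fractional ideal of series [f] with [f = O(t^n)]; [ordge 0] is
    [power_series]. *)
Definition ordge n : set (laurent K) := [set f | forall k, k < n -> lcoef f k = 0].

Lemma ordgeW a b f : a <= b -> ordge b f -> ordge a f.
Proof. by move=> ab fb k ka; apply: fb; apply: lt_le_trans ka ab. Qed.

Lemma ordge0 a : ordge a 0. Proof. by []. Qed.

Lemma ordgeD a f g : ordge a f -> ordge a g -> ordge a (f + g).
Proof. by move=> fa ga k ka; rewrite /= fa// ga// addr0. Qed.

Lemma ordgeN a f : ordge a f -> ordge a (- f).
Proof. by move=> fa k ka; rewrite /= fa// oppr0. Qed.

Lemma ordgeB a f g : ordge a f -> ordge a g -> ordge a (f - g).
Proof. by move=> fa ga; apply: ordgeD fa _; exact: ordgeN. Qed.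

Lemma ordgeNE a f : ordge a (- f) <-> ordge a f.
Proof. by split=> [/ordgeN|/ordgeN//]; rewrite opprK. Qed.

Lemma lcoefD f g k : lcoef (f + g) k = lcoef f k + lcoef g k. Proof. by []. Qed.

Lemma lcoefN f k : lcoef (- f) k = - lcoef f k. Proof. by []. Qed.

Lemma lcoef_sum (I : Type) (r : seq I) (F : I -> laurent K) k :
  lcoef (\sum_(i <- r) F i) k = \sum_(i <- r) lcoef (F i) k.
Proof. exact: (big_morph (fun f => lcoef f k)). Qed.

Lemma lcoef_monomM c m f k : lcoef (lmonom c m * f) k = c * lcoef f (k - m).
Proof.
rewrite [LHS]/= /lmul_coef -(fsbig_widen [set m])//; last first.
  by move=> i [_ /eqP im]; rewrite /= (negPf im) mul0r.
by rewrite fsbig_set1 /= eqxx.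
Qed.

Lemma lmonomM c d a b : lmonom c a * lmonom d b = lmonom (c * d) (a + b) :> laurent K.
Proof.
apply: laurentP => k; rewrite lcoef_monomM /= subr_eq (addrC b).
by case: eqP => //; rewrite mulr0.
Qed.

Lemma lmonom10 : lmonom 1 0 = 1 :> laurent K.
Proof. by apply: laurentP => k /=; case: eqP. Qed.

Lemma tpowD a b : tpow K a * tpow K b = tpow K (a + b).
Proof. by rewrite lmonomM mulr1. Qed.

Lemma tpow0 : tpow K 0 = 1. Proof. exact: lmonom10. Qed.

Lemma tpowNK a : tpow K (- a) * tpow K a = 1.
Proof. by rewrite tpowD addNr tpow0. Qed.

Lemma ordge_monom c a b : a <= b -> ordge a (lmonom c b).
Proof. by move=> ab k ka /=; case: eqP => // kb; move: ka; lia. Qed.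

Lemma ordge_const c : ordge 0 (lconst c). Proof. exact: ordge_monom. Qed.

Lemma ordge1 : ordge 0 (1 : laurent K).
Proof. rewrite -tpow0; exact: ordge_monom. Qed.

Lemma lcoef_tpowM m f k : lcoef (tpow K m * f) k = lcoef f (k - m).
Proof. by rewrite /tpow lcoef_monomM mul1r. Qed.

Lemma lcoef_constM c f k : lcoef (lconst c * f) k = c * lcoef f k.
Proof. by rewrite /lconst lcoef_monomM subr0. Qed.

Lemma ordge_tpowM a m f : ordge a (tpow K m * f) <-> ordge (a - m) f.
Proof.
split=> fa k ka.
  by have := fa (k + m); rewrite lcoef_tpowM addrK; apply; move: ka; lia.
by rewrite lcoef_tpowM fa//; move: ka; lia.
Qed.

Lemma lcoefM0 f g (n : nat) : ordge 0 f -> ordge 0 g ->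
  lcoef (f * g) n%:Z = \sum_(i < n.+1) lcoef f i * lcoef g (n - i)%N.
Proof.
move=> f0 g0; rewrite [LHS]/= (@lmul_coefE _ f g 0 0 n%:Z n.+1)//.
  by apply: eq_bigr => i _; rewrite subr0 addr0 subzn// -ltnS.
by rewrite !addr0 ltz_nat.
Qed.

Lemma ordge_split a f : ordge a f -> exists2 f', ordge 0 f' & f = tpow K a * f'.
Proof.
move=> fa; exists (tpow K (- a) * f).
  by apply/ordge_tpowM; rewrite opprK add0r.
by rewrite mulrA tpowD subrr tpow0 mul1r.
Qed.

Lemma ordgeM a b f g : ordge a f -> ordge b g -> ordge (a + b) (f * g).
Proof.
move=> /ordge_split[f' f0 ->] /ordge_split[g' g0 ->].
rewrite mulrACA tpowD; apply/ordge_tpowM; rewrite subrr => k k0.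
by apply: (@lmul_coef_below _ f' g' 0 0) => //; rewrite oppr0.
Qed.

Lemma ordgeM0 f g : ordge 0 f -> ordge 0 g -> ordge 0 (f * g).
Proof. by move=> f0 g0; rewrite -[0]addr0; exact: ordgeM. Qed.

Lemma lcoefM_lead a b f g : ordge a f -> ordge b g ->
  lcoef (f * g) (a + b) = lcoef f a * lcoef g b.
Proof.
move=> /ordge_split[f' f0 ->] /ordge_split[g' g0 ->].
rewrite [in RHS](lcoef_tpowM a f') [in RHS](lcoef_tpowM b g') mulrACA tpowD.
rewrite lcoef_tpowM !subrr.
by rewrite (@lcoefM0 _ _ 0)// big_ord1.
Qed.

Lemma lcoefM00 f g : ordge 0 f -> ordge 0 g ->
  lcoef (f * g) 0 = lcoef f 0 * lcoef g 0.
Proof. by move=> f0 g0; rewrite -[in LHS](addr0 0) lcoefM_lead. Qed.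

Lemma lcoefM01 f g : ordge 0 f -> ordge 0 g ->
  lcoef (f * g) 1 = lcoef f 0 * lcoef g 1 + lcoef f 1 * lcoef g 0.
Proof. by move=> f0 g0; rewrite (@lcoefM0 _ _ 1)// !big_ord_recl big_ord0 addr0. Qed.

(** The first [n] coefficients of the power series [g / f]: each is solved for
    from the previous ones, as [f 0] is invertible. *)
Fixpoint lquo_seq f g (n : nat) : seq K :=
  if n is m.+1 then
    let s := lquo_seq f g m in
    rcons s ((lcoef g m - \sum_(i < m) s`_i * lcoef f (m - i)%N) / lcoef f 0)
  else [::].

Lemma size_lquo_seq f g (n : nat) : size (lquo_seq f g n) = n.
Proof. by elim: n => //= n IH; rewrite size_rcons IH. Qed.

Lemma nth_lquo_seq f g (i n : nat) : (i < n)%N ->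
  (lquo_seq f g n)`_i = (lquo_seq f g i.+1)`_i.
Proof.
elim: n => // n IH; rewrite ltnS leq_eqVlt => /predU1P[->//|iltn].
by rewrite [in LHS]/= nth_rcons size_lquo_seq iltn IH.
Qed.

Lemma ldiv_exists f g : ordge 0 f -> lcoef f 0 != 0 -> ordge 0 g ->
  exists2 x, ordge 0 x & x * f = g.
Proof.
move=> f0 fn0 g0.
pose xc k : K := if k is Posz n then (lquo_seq f g n.+1)`_n else 0.
have xb : exists N : nat, forall k, k < - N%:Z -> xc k = 0.
  by exists 0%N => -[].
pose x : laurent K := Laurent xb.
have x0 : ordge 0 x by case.
exists x => //; apply: laurentP => -[n|n]; last first.
  by rewrite g0// -(addr0 0) (ordgeM x0 f0)// addr0.
rewrite lcoefM0// big_ord_recr /= subnn nth_rcons size_lquo_seq ltnn eqxx.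
rewrite divfK// addrC. rewrite [X in _ + X](eq_bigr
  (fun i : 'I_n => (lquo_seq f g n)`_i * lcoef f (n - i)%N)) ?subrK// => i _.
by rewrite [in RHS]nth_lquo_seq.
Qed.

Lemma linv_exists a f : ordge a f -> lcoef f a != 0 ->
  exists g, [/\ ordge (- a) g, lcoef g (- a) != 0 & f * g = 1].
Proof.
move=> /ordge_split[f' f0 ->]; rewrite lcoef_tpowM subrr => fn0.
have [g g0 gf] := ldiv_exists f0 fn0 ordge1.
exists (tpow K (- a) * g); split.
- by apply/ordge_tpowM; rewrite subrr.
- rewrite lcoef_tpowM subrr; have := congr1 (fun h => lcoef h 0) gf.
  rewrite lcoefM00//= => /eqP; apply: contraTneq => ->.
  by rewrite mul0r eq_sym oner_eq0.
- by rewrite mulrACA tpowD subrr tpow0 mul1r mulrC.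
Qed.

Lemma lrotM c f g : c != 0 -> lrot c (f * g) = lrot c f * lrot c g.
Proof.
move=> c0; have [a fa] := lcoef_bounded f; have [b gb] := lcoef_bounded g.
have fa' : lbelow (lrot c f) a by move=> k /fa /= ->; rewrite mulr0.
have gb' : lbelow (lrot c g) b by move=> k /gb /= ->; rewrite mulr0.
apply: laurentP => k; pose n := (absz (k + a + b)).+1.
have kn : k + a%:Z + b%:Z < n%:Z by rewrite /n; lia.
rewrite /= (lmul_coefE fa gb kn) (lmul_coefE fa' gb' kn) mulr_sumr.
apply: eq_bigr => i _ /=; rewrite mulrACA -expfzDr//; congr (_ ^ _ * _); lia.
Qed.

Lemma lrotD c f g : lrot c (f + g) = lrot c f + lrot c g.
Proof. by apply: laurentP => k /=; rewrite mulrDr. Qed.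

Lemma lrotN c f : lrot c (- f) = - lrot c f.
Proof. by apply: laurentP => k /=; rewrite mulrN. Qed.

Lemma lrot_monom c d m : lrot c (lmonom d m) = lmonom (c ^ m * d) m :> laurent K.
Proof. by apply: laurentP => k /=; case: eqP => [->//|]; rewrite mulr0. Qed.

Lemma lrot1 c : lrot c 1 = 1 :> laurent K.
Proof. by rewrite -lmonom10 lrot_monom expr0z mulr1. Qed.

Lemma lrot0 c : lrot c 0 = 0 :> laurent K.
Proof. by apply: laurentP => k /=; rewrite mulr0. Qed.

Lemma lrotK c : c != 0 -> cancel (@lrot K c^-1) (lrot c).
Proof.
move=> c0 f; apply: laurentP => k /=.
by rewrite exprz_inv mulrA -expfzDr// subrr expr0z mul1r.
Qed.

Lemma ordge_lrot a c f : ordge a f -> ordge a (lrot c f).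
Proof. by move=> fa k /fa /= ->; rewrite mulr0. Qed.

End LaurentSeries.

(** * Two-by-two matrices of determinant one *)
Section TwoByTwo.
Variable A : comNzRingType.
Implicit Types (a b c d x y : A) (g h : 'M[A]_2).

Lemma mx2_00 a b c d : mx2 a b c d 0 0 = a. Proof. by rewrite mxE. Qed.
Lemma mx2_01 a b c d : mx2 a b c d 0 1 = b. Proof. by rewrite mxE. Qed.
Lemma mx2_10 a b c d : mx2 a b c d 1 0 = c. Proof. by rewrite mxE. Qed.
Lemma mx2_11 a b c d : mx2 a b c d 1 1 = d. Proof. by rewrite mxE. Qed.
Definition mx2E := (mx2_00, mx2_01, mx2_10, mx2_11).

Lemma mx2_eta g : g = mx2 (g 0 0) (g 0 1) (g 1 0) (g 1 1).
Proof.
apply/matrixP => -[[|[|i]] Hi] [[|[|j]] Hj] //; rewrite mxE /=;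
by congr (g _ _); apply/val_inj.
Qed.

Lemma mulmx_mx2 a b c d a' b' c' d' : mx2 a b c d *m mx2 a' b' c' d' =
  mx2 (a * a' + b * c') (a * b' + b * d') (c * a' + d * c') (c * b' + d * d').
Proof.
apply/matrixP => i j; rewrite !mxE !big_ord_recl big_ord0 !mxE /= addr0.
by case: (i == 0); case: (j == 0).
Qed.

Lemma det_mx2 a b c d : \det (mx2 a b c d) = a * d - b * c.
Proof.
rewrite (expand_det_row _ 0) !big_ord_recl big_ord0 /cofactor !det_mx11 !mxE /=.
by rewrite expr0 expr1 mul1r mulN1r mulrN addr0.
Qed.

Lemma mx2_1 : mx2 1 0 0 1 = 1 :> 'M[A]_2.
Proof. by rewrite [RHS]mx2_eta !mxE. Qed.

(** The adjugate, which is the inverse of a matrix of determinant 1. *)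
Definition adj2 g := mx2 (g 1 1) (- g 0 1) (- g 1 0) (g 0 0).

Lemma adj2_mx2 a b c d : adj2 (mx2 a b c d) = mx2 d (- b) (- c) a.
Proof. by rewrite /adj2 !mx2E. Qed.

Lemma adj2M g h : adj2 (g *m h) = adj2 h *m adj2 g.
Proof.
rewrite (mx2_eta g) (mx2_eta h) mulmx_mx2 !adj2_mx2 mulmx_mx2.
by congr mx2; ring.
Qed.

Lemma adj2K g : adj2 (adj2 g) = g.
Proof. by rewrite /adj2 !mx2E !opprK -mx2_eta. Qed.

Lemma det_adj2 g : \det (adj2 g) = \det g.
Proof. rewrite (mx2_eta g) adj2_mx2 !det_mx2; ring. Qed.

Lemma mulmx_adj2 g : \det g = 1 -> g *m adj2 g = 1.
Proof.
rewrite (mx2_eta g) adj2_mx2 det_mx2 mulmx_mx2 -mx2_1 => <-.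
by congr mx2; ring.
Qed.

Lemma mul_adj2mx g : \det g = 1 -> adj2 g *m g = 1.
Proof. by rewrite -det_adj2 => /mulmx_adj2; rewrite adj2K. Qed.

Definition umx x := mx2 1 x 0 1.
Definition lmx x := mx2 1 0 x 1.

Lemma det_umx x : \det (umx x) = 1.
Proof. by rewrite det_mx2; ring. Qed.

Lemma det_lmx x : \det (lmx x) = 1.
Proof. by rewrite det_mx2; ring. Qed.

Lemma adj2_umxM x y : adj2 (umx y) *m umx x = umx (x - y).
Proof. by rewrite adj2_mx2 mulmx_mx2; congr mx2; ring. Qed.

Lemma adj2_lmxM x y : adj2 (lmx y) *m lmx x = lmx (x - y).
Proof. by rewrite adj2_mx2 mulmx_mx2; congr mx2; ring. Qed.

End TwoByTwo.

(** * Conjugates of the Iwahori subgroup by monomial matrices *)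
Section IwahoriConjugates.
Variable K : fieldType.
Local Notation L := (laurent K).
Implicit Types (a b c d : L) (k g h : 'M[L]_2) (m n : int) (e : bool).

(** The conjugate of the Iwahori subgroup by a monomial matrix of level [m]
    ([conj_wmx]); [m = 0] is the Iwahori subgroup itself ([iwahoriE]). *)
Definition iwahori_conj m : set 'M[L]_2 :=
  [set k | \det k = 1 /\ [/\ ordge 0 (k 0 0), ordge m (k 0 1),
                             ordge (1 - m) (k 1 0) & ordge 0 (k 1 1)]].

Lemma iwahori_conj_mx2 m a b c d : iwahori_conj m (mx2 a b c d) <->
  a * d - b * c = 1 /\ [/\ ordge 0 a, ordge m b, ordge (1 - m) c & ordge 0 d].
Proof. by rewrite /iwahori_conj /= det_mx2 !mx2E. Qed.

Lemma iwahori_conjM m g h :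
  iwahori_conj m g -> iwahori_conj m h -> iwahori_conj m (g *m h).
Proof.
move=> [dg [g0 g1 g2 g3]] [dh [h0 h1 h2 h3]].
split; first by rewrite det_mulmx dg dh mulr1.
rewrite [_ *m _]mx2_eta (mx2_eta g) (mx2_eta h) mulmx_mx2 !mx2E.
split; apply: ordgeD.
- exact: ordgeM0.
- by apply: (@ordgeW _ _ (m + (1 - m))); [lia|exact: ordgeM].
- by rewrite -[m]add0r; apply: ordgeM => //; rewrite add0r.
- by rewrite -[m]addr0; apply: ordgeM => //; rewrite addr0.
- by rewrite -[X in ordge X]addr0; apply: ordgeM.
- by rewrite -[X in ordge X]add0r; apply: ordgeM.
- by apply: (@ordgeW _ _ (1 - m + m)); [lia|exact: ordgeM].
- exact: ordgeM0.
Qed.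

Lemma iwahori_conjV m g : iwahori_conj m g -> iwahori_conj m (adj2 g).
Proof.
move=> [dg [g0 g1 g2 g3]]; split; first by rewrite det_adj2.
by rewrite !mx2E; split=> //; apply/ordgeNE.
Qed.

Lemma iwahori_conj_umx m b : iwahori_conj m (umx b) <-> ordge m b.
Proof.
rewrite iwahori_conj_mx2; split=> [[_ []]//|bm].
by split; [ring|split=> //; exact: ordge1].
Qed.

Lemma iwahori_conj_lmx m c : iwahori_conj m (lmx c) <-> ordge (1 - m) c.
Proof.
rewrite iwahori_conj_mx2; split=> [[_ []]//|bm].
by split; [ring|split=> //; exact: ordge1].
Qed.

Lemma iwahori_conj_diag m a d : ordge 0 a -> ordge 0 d -> a * d = 1 ->
  iwahori_conj m (mx2 a 0 0 d).
Proof. by move=> a0 d0 ad; apply/iwahori_conj_mx2; split; [rewrite ad; ring|]. Qed.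

(** The monomial matrices underlying [bracket] ([e = false]) and [bracket']
    ([e = true]). *)
Definition wmx e n : 'M[L]_2 :=
  if e then mx2 0 (tpow K n) (- tpow K (- n)) 0
  else mx2 (tpow K n) 0 0 (tpow K (- n)).

(** The exponent [m] for which [w I w^-1] is [iwahori_conj m]. *)
Definition level e n : int := 2 * n + (e : nat)%:Z.

Lemma tpowNK' n : tpow K n * tpow K (- n) = 1.
Proof. by rewrite mulrC tpowNK. Qed.

Lemma det_wmx e n : \det (wmx e n) = 1.
Proof.
by case: e; rewrite det_mx2 ?mulr0 ?mul0r ?subr0 ?sub0r ?mulrN ?opprK tpowNK'.
Qed.

Lemma tpow2 n : tpow K (2 * n) = tpow K n * tpow K n.
Proof. by rewrite tpowD; congr tpow; lia. Qed.

Lemma conj_wmx_mx2 e n a b c d :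
  adj2 (wmx e n) *m mx2 a b c d *m wmx e n =
  if e then mx2 d (- (tpow K (2 * n) * c)) (- (tpow K (- (2 * n)) * b)) a
  else mx2 a (tpow K (- (2 * n)) * b) (tpow K (2 * n) * c) d.
Proof.
have t1 := tpowNK' n; have t2 : tpow K (- (2 * n)) = tpow K (- n) * tpow K (- n).
  by rewrite -tpow2; congr tpow; lia.
rewrite /wmx t2 tpow2; case: e; rewrite adj2_mx2 !mulmx_mx2; congr mx2; ring: t1.
Qed.

Lemma conj_wmx e n k : \det k = 1 ->
  iwahori_conj 0 (adj2 (wmx e n) *m k *m wmx e n) <-> iwahori_conj (level e n) k.
Proof.
move=> dk; have dk' : \det (adj2 (wmx e n) *m k *m wmx e n) = 1.
  by rewrite !det_mulmx det_adj2 det_wmx dk !mulr1.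
rewrite /iwahori_conj /= dk dk' {dk dk'} (mx2_eta k) conj_wmx_mx2 /level.
have ordgeN_eq i (f : L) : ordge i (- f) = ordge i f.
  by apply/propext/ordgeNE.
have tpow_eq i j (f : L) : ordge i (tpow K j * f) = ordge (i - j) f.
  by apply/propext/ordge_tpowM.
have ordgeE (i j : int) (f : L) : i = j -> ordge i f -> ordge j f by move=> ->.
case: e; rewrite !mx2E ?ordgeN_eq !tpow_eq; split=> -[_ []] h1 h2 h3 h4.
- by split=> //; split=> //; [apply: ordgeE h3|apply: ordgeE h2]; lia.
- by split=> //; split=> //; [apply: ordgeE h3|apply: ordgeE h2]; lia.
- by split=> //; split=> //; [apply: ordgeE h2|apply: ordgeE h3]; lia.
- by split=> //; split=> //; [apply: ordgeE h2|apply: ordgeE h3]; lia.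
Qed.

End IwahoriConjugates.

(** * Points of the flag variety and the upper unipotent chart *)
Section Cells.
Variable R : realType.
Local Notation C := R[i].
Local Notation L := (laurent C).
Local Notation M := 'M[L]_2.
Implicit Types (x y s : L) (g h k : M) (n m : int) (e : bool) (P Q : set L).

Lemma iwahoriE : @iwahori R = iwahori_conj 0.
Proof.
apply/seteqP; split=> g.
  move=> [a [b [c [d [[a0 b0 c0 d0] det1 ->]]]]]; apply/iwahori_conj_mx2.
  split; first by rewrite -det1; ring.
  by split=> //; apply/ordge_tpowM; rewrite subr0 subrr.
move=> [det1 [g0 g1 g2 g3]].
have [c c0 gc] := ordge_split g2; rewrite subr0 in gc.
exists (g 0 0), (g 0 1), c, (g 1 1); split=> //.
  by rewrite -det1 (mx2_eta g) det_mx2 !mx2E gc; ring.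
by rewrite -gc -mx2_eta.
Qed.

Lemma iwahori1 : @iwahori R 1.
Proof.
by rewrite iwahoriE -mx2_1; apply: iwahori_conj_diag; rewrite ?mulr1//; exact: ordge1.
Qed.

(** The inverse of the transition matrix is its adjugate and the Iwahori is a
    group, so one transition matrix controls both inclusions. *)
Lemma coset_eqP g h : \det g = 1 -> \det h = 1 ->
  coset g = coset h <-> iwahori_conj 0 (adj2 h *m g).
Proof.
have sub g' h' : \det h' = 1 -> iwahori_conj 0 (adj2 h' *m g') ->
    coset g' `<=` coset h'.
  move=> dh I_hg _ [u Iu <-]; exists (adj2 h' *m g' *m u).
    by rewrite iwahoriE in Iu *; exact: iwahori_conjM.
  by rewrite !mulmxA mulmx_adj2// mul1mx.
move=> dg dh; split=> [gh|I_hg].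
  have : coset g g by exists 1; [exact: iwahori1|rewrite mulmx1].
  rewrite gh => -[u Iu <-].
  by rewrite mulmxA mul_adj2mx// mul1mx -iwahoriE.
apply/seteqP; split; apply: sub => //.
by rewrite -[g in adj2 g](adj2K g) -[h](adj2K h) -adj2M adj2K; exact: iwahori_conjV.
Qed.

Lemma lact_coset g h : lact g (coset h) = coset (g *m h).
Proof.
apply/seteqP; split=> u.
  by move=> [_ [v Iv <-] <-]; exists v; rewrite ?mulmxA.
by move=> [v Iv <-]; exists (h *m v); [exists v|rewrite mulmxA].
Qed.

Lemma lrot_mx2 (c : C) (x y z t : L) :
  map_mx (lrot c) (mx2 x y z t) = mx2 (lrot c x) (lrot c y) (lrot c z) (lrot c t).
Proof. by rewrite [LHS]mx2_eta !mxE. Qed.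

Lemma lrot_mulmx (c : C) g h : c != 0 ->
  map_mx (lrot c) (g *m h) = map_mx (lrot c) g *m map_mx (lrot c) h.
Proof.
move=> c0; rewrite (mx2_eta g) (mx2_eta h) mulmx_mx2 !lrot_mx2 mulmx_mx2.
by rewrite !lrotD !lrotM.
Qed.

Lemma iwahori_lrot (c : C) g : c != 0 -> iwahori g -> iwahori (map_mx (lrot c) g).
Proof.
rewrite iwahoriE => c0; rewrite (mx2_eta g) lrot_mx2 !iwahori_conj_mx2.
move=> [det1 [g0 g1 g2 g3]]; split.
  by rewrite -!lrotM// -lrotN -lrotD det1 lrot1.
by split; exact: ordge_lrot.
Qed.

Lemma rot_coset (c : C) g : c != 0 -> Defs.rot c (coset g) = coset (map_mx (lrot c) g).
Proof.
move=> c0; apply/seteqP; split=> u.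
  move=> [_ [v Iv <-] <-]; exists (map_mx (lrot c) v); first exact: iwahori_lrot.
  by rewrite lrot_mulmx.
move=> [v Iv <-]; exists (g *m map_mx (lrot c^-1) v).
  by exists (map_mx (lrot c^-1) v) => //; apply: iwahori_lrot; rewrite ?invr_eq0.
rewrite lrot_mulmx//; congr (_ *m _).
by apply/matrixP => i j; rewrite !mxE lrotK.
Qed.

(** Every point of the flag variety has this form, for each fixed monomial
    matrix; [k] is then determined up to right multiplication by
    [iwahori_conj (level e n)]. *)
Definition wpt e n k : set M := coset (k *m wmx C e n).

Lemma flag_wpt e n k : \det k = 1 -> flag (wpt e n k).
Proof.
by move=> dk; exists (k *m wmx C e n) => //; rewrite /SL2 /= det_mulmx dk det_wmx mulr1.
Qed.

Lemma adj2_mulmxM g h k : adj2 (g *m k) *m (h *m k) = adj2 k *m (adj2 g *m h) *m k.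
Proof. by rewrite adj2M !mulmxA. Qed.

Lemma wpt_eqP e n k h : \det k = 1 -> \det h = 1 ->
  wpt e n k = wpt e n h <-> iwahori_conj (level e n) (adj2 h *m k).
Proof.
move=> dk dh; rewrite -conj_wmx; last by rewrite det_mulmx det_adj2 dk dh mulr1.
rewrite /wpt coset_eqP ?det_mulmx ?dk ?dh ?det_wmx ?mulr1//.
rewrite adj2_mulmxM.
exact: iff_refl.
Qed.

Lemma wpt_mulr e n k h : \det k = 1 -> iwahori_conj (level e n) h ->
  wpt e n (k *m h) = wpt e n k.
Proof.
move=> dk Ih; have [dh _] := Ih; apply/wpt_eqP => //.
  by rewrite det_mulmx dk dh mulr1.
by rewrite mulmxA mul_adj2mx// mul1mx.
Qed.

(** The upper unipotent chart has coordinate [x] mod [t^m]. *)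
Lemma wpt_umx_eq e n x y :
  wpt e n (umx x) = wpt e n (umx y) <-> ordge (level e n) (x - y).
Proof. by rewrite wpt_eqP ?det_umx// adj2_umxM iwahori_conj_umx. Qed.

(** The lower unipotent chart has coordinate [s] mod [t^(1-m)]. *)
Lemma wpt_lmx_eq e n x y :
  wpt e n (lmx x) = wpt e n (lmx y) <-> ordge (1 - level e n) (x - y).
Proof. by rewrite wpt_eqP ?det_lmx// adj2_lmxM iwahori_conj_lmx. Qed.

Lemma lact_wpt e n g k : lact g (wpt e n k) = wpt e n (g *m k).
Proof. by rewrite /wpt lact_coset mulmxA. Qed.

Definition ucell e n P : set (set M) := [set wpt e n (umx x) | x in P].
Definition lcell e n P : set (set M) := [set wpt e n (lmx s) | s in P].

Lemma lconstV (al : C) : al != 0 -> lconst al * lconst al^-1 = 1.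
Proof. by move=> al0; rewrite lmonomM mulfV// addr0 lmonom10. Qed.

(** Everything that the orbit computations use about [I4]: modulo [t^2] its
    elements are diagonal and constant. *)
Lemma I4_coefs h : I4 h -> exists2 alpha : C, alpha != 0 & exists A B G D : L,
  [/\ h = mx2 A B G D, A * D - B * G = 1,
   [/\ ordge 0 A, lcoef A 0 = alpha & lcoef A 1 = 0],
   ordge 2 B /\ ordge 2 G &
   [/\ ordge 0 D, lcoef D 0 = alpha^-1 & lcoef D 1 = 0]].
Proof.
have diag (be : C) (a : L) : ordge 0 a -> let A := lconst be * (1 + tpow C 2 * a) in
    [/\ ordge 0 A, lcoef A 0 = be & lcoef A 1 = 0].
  move=> a0; have ta : ordge 2 (tpow C 2 * a) by apply/ordge_tpowM; rewrite subrr.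
  have t1 : ordge 0 (1 + tpow C 2 * a).
    by apply: ordgeD; [exact: ordge1|exact: ordgeW ta].
  move=> A; rewrite {}/A; split; first by apply: ordgeM0 => //; exact: ordge_const.
  - by rewrite lcoef_constM lcoefD ta// addr0 mulr1.
  - by rewrite lcoef_constM lcoefD ta// addr0 mulr0.
move=> [al [a [b [c [d [al0 [a0 b0 c0 d0] det1 ->]]]]]].
exists al => //; do 4!eexists; split; [reflexivity| |exact: diag| |exact: diag].
  have alV := lconstV al0.
  have e1 : a + d + tpow C 2 * (a * d) = tpow C 2 * (b * c).
    by apply/eqP; rewrite -subr_eq0 -det1; apply/eqP; ring.
  transitivity (lconst al * lconst al^-1 *
    (1 + tpow C 2 * (a + d + tpow C 2 * (a * d))) - tpow C 2 * (tpow C 2 * (b * c))).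
    by ring.
  by rewrite alV e1; ring.
by split; apply/ordge_tpowM; rewrite subrr.
Qed.

Lemma I4_mx2 (al : C) (B G : L) : al != 0 -> ordge 2 B -> ordge 2 G -> B * G = 0 ->
  I4 (mx2 (lconst al) B G (lconst al^-1)).
Proof.
move=> al0 /ordge_split[b b0 ->] /ordge_split[c c0 ->] BG0.
exists al, 0, b, c, 0; split=> //.
  suff bc0 : b * c = 0 by rewrite bc0; ring.
  transitivity (tpow C (- 2) * tpow C 2 * (tpow C (- 2) * tpow C 2) * (b * c)).
    by rewrite tpowNK !mul1r.
  transitivity (tpow C (- 2) * tpow C (- 2) * (tpow C 2 * b * (tpow C 2 * c))).
    by ring.
  by rewrite BG0 mulr0.
by rewrite mulr0 addr0 !mulr1.
Qed.

(** The class of [x] for the action of [C^*] on the two lowest coefficients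
    through squares. *)
Definition scaling_class x : set L := [set y | ordge 0 y /\ exists2 alpha : C,
  alpha != 0 & lcoef y 0 = alpha ^+ 2 * lcoef x 0 /\
               lcoef y 1 = alpha ^+ 2 * lcoef x 1].

(** [I4] acts on the coordinate [x] by Moebius transformations, and the lower
    triangular factor left over has its corner in [t^2 C[[t]]]; the bound on the
    level is exactly what makes the monomial matrix absorb it.  Conversely upper
    triangular elements of [I4] already reach the whole scaling class. *)
Lemma I4_orbit_ucell e n x : -1 <= level e n -> ordge 0 x ->
  I4_orbit (wpt e n (umx x)) = ucell e n (scaling_class x).
Proof.
move=> lev x0; apply/seteqP; split=> X.
  move=> [h /I4_coefs[al al0 [A [B [G [D [-> det1]]]]]]].
  move=> [A0 Aal A1] [B2 G2] [D0 Dal D1] <-.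
  have G0 : ordge 0 G by exact: ordgeW G2.
  pose w := G * x + D.
  have Gx2 : ordge 2 (G * x) by have := ordgeM G2 x0; rewrite addr0.
  have Gx0 : ordge 0 (G * x) by exact: ordgeW Gx2.
  have w0 : ordge 0 w by exact: ordgeD.
  have wal : lcoef w 0 = al^-1 by rewrite lcoefD Gx2// add0r.
  have w1 : lcoef w 1 = 0 by rewrite lcoefD Gx2// add0r.
  have Ax0 : ordge 0 (A * x) by exact: ordgeM0.
  have [y y0 yw] : exists2 y, ordge 0 y & y * w = A * x + B.
    apply: ldiv_exists => //; first by rewrite wal invr_eq0.
    by apply: ordgeD => //; exact: ordgeW B2.
  (* Coefficients of [y w = A x + B] at 0 and 1, where [w] is [al^-1] mod [t^2]. *)
  exists y; first split=> //.
    exists al => //; have := congr1 (fun f => lcoef f 0) yw.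
    have := congr1 (fun f => lcoef f 1) yw.
    rewrite !lcoefD !lcoefM01 ?lcoefM00 // wal w1 Aal A1 !B2//.
    rewrite !addr0 mul0r addr0 mulr0 add0r.
    by move=> e1 e0; rewrite !expr2 -!mulrA -e1 -e0 ![al * (_ * al^-1)]mulrC !mulfVK.
  rewrite lact_wpt.
  (* The corner [A - y G] is the inverse of [w], because the determinant is 1. *)
  have -> : mx2 A B G D *m umx x = umx y *m mx2 (A - y * G) 0 G w.
    by rewrite !mulmx_mx2; congr mx2; rewrite ?yw /w; ring: yw.
  rewrite wpt_mulr ?det_umx//; apply/iwahori_conj_mx2; split.
    transitivity (A * w - y * w * G); first by ring.
    by rewrite yw -det1 /w; ring.
  split=> //; first by apply: ordgeB => //; exact: ordgeM0.
  by apply: ordgeW G2; lia.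
move=> [y [y0 [al al0 [e0 e1]]] <-].
have alV := lconstV al0.
(* Solve [al (al x + B) = y] for [B]: the hypotheses on the two lowest
   coefficients say that [B] is in [t^2 C[[t]]]. *)
exists (mx2 (lconst al) (lconst al^-1 * y - lconst al * x) 0 (lconst al^-1)).
  apply: I4_mx2 => //; last by rewrite mulr0.
  move=> k k2; rewrite lcoefD lcoefN !lcoef_constM.
  have [k0|k0] := ltP k 0; first by rewrite x0// y0// !mulr0 subrr.
  have al_K z : al^-1 * (al ^+ 2 * z) - al * z = 0.
    by rewrite expr2 mulrA mulKf// subrr.
  have [->|->] : k = 0 \/ k = 1 by lia.
    by rewrite e0.
  by rewrite e1.
rewrite lact_wpt.
have -> : mx2 (lconst al) (lconst al^-1 * y - lconst al * x) 0 (lconst al^-1)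
    *m umx x = umx y *m mx2 (lconst al) 0 0 (lconst al^-1).
  by rewrite !mulmx_mx2; congr mx2; ring.
rewrite wpt_mulr ?det_umx//; apply: iwahori_conj_diag => //; exact: ordge_const.
Qed.

End Cells.

(** * Orbits, the lower unipotent chart and brackets *)
Section Orbits.
Variable R : realType.
Local Notation C := R[i].
Local Notation L := (laurent C).
Local Notation M := 'M[L]_2.
Implicit Types (x y s p : L) (g h : M) (n m k : int) (e : bool) (P Q : C -> C -> Prop).

(** The mirror image of [I4_orbit_ucell]: the factor left over is now upper
    triangular with its corner in [t^2 C[[t]]], hence the bound on the level. *)
Lemma I4_orbit_lcell e n s : level e n <= 2 -> ordge 0 s ->
  I4_orbit (wpt e n (lmx s)) = lcell e n (scaling_class s).
Proof.
move=> lev s0; apply/seteqP; split=> X.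
  move=> [h /I4_coefs[al al0 [A [B [G [D [-> det1]]]]]]].
  move=> [A0 Aal A1] [B2 G2] [D0 Dal D1] <-.
  have B0 : ordge 0 B by exact: ordgeW B2.
  pose w := A + B * s.
  have Bs2 : ordge 2 (B * s) by have := ordgeM B2 s0; rewrite addr0.
  have w0 : ordge 0 w by apply: ordgeD => //; exact: ordgeW Bs2.
  have wal : lcoef w 0 = al by rewrite lcoefD Bs2// addr0.
  have w1 : lcoef w 1 = 0 by rewrite lcoefD Bs2// addr0.
  have Ds0 : ordge 0 (D * s) by exact: ordgeM0.
  have [y y0 yw] : exists2 y, ordge 0 y & y * w = G + D * s.
    apply: ldiv_exists => //; first by rewrite wal.
    by apply: ordgeD => //; exact: ordgeW G2.
  (* Coefficients of [y w = G + D s] at 0 and 1, where [w] is [al] mod [t^2]. *)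
  exists y; first split=> //.
    exists al^-1; rewrite ?invr_eq0//; have := congr1 (fun f => lcoef f 0) yw.
    have := congr1 (fun f => lcoef f 1) yw.
    rewrite !lcoefD !lcoefM01 ?lcoefM00 // wal w1 Dal D1 !G2//.
    rewrite !add0r mul0r addr0 mulr0 add0r.
    by move=> e1 e0; rewrite !expr2 -!mulrA -e1 -e0 ![al^-1 * (_ * al)]mulrC !mulfK.
  rewrite lact_wpt.
  have -> : mx2 A B G D *m lmx s = lmx y *m mx2 w B 0 (D - y * B).
    rewrite !mulmx_mx2; congr mx2; rewrite /w; try ring.
    by rewrite mulr0 addr0 yw mulr1.
  rewrite wpt_mulr ?det_lmx//; apply/iwahori_conj_mx2; split.
    transitivity (D * w - y * w * B); first by ring.
    by rewrite yw -det1 /w; ring.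
  split=> //; first by apply: ordgeW B2.
  by apply: ordgeB => //; exact: ordgeM0.
move=> [y [y0 [al al0 [e0 e1]]] <-].
have alV := lconstV al0.
exists (mx2 (lconst al^-1) 0 (lconst al^-1 * y - lconst al * s) (lconst al^-1^-1)).
  apply: I4_mx2; rewrite ?invr_eq0 ?mul0r//.
  move=> k k2; rewrite lcoefD lcoefN !lcoef_constM.
  have [k0|k0] := ltP k 0; first by rewrite s0// y0// !mulr0 subrr.
  have al_K z : al^-1 * (al ^+ 2 * z) - al * z = 0.
    by rewrite expr2 mulrA mulKf// subrr.
  have [->|->] : k = 0 \/ k = 1 by lia.
    by rewrite e0.
  by rewrite e1.
rewrite lact_wpt invrK.
have -> : mx2 (lconst al^-1) 0 (lconst al^-1 * y - lconst al * s) (lconst al)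
    *m lmx s = lmx y *m mx2 (lconst al^-1) 0 0 (lconst al).
  by rewrite !mulmx_mx2; congr mx2; ring.
rewrite wpt_mulr ?det_lmx//.
by apply: iwahori_conj_diag; rewrite 1?mulrC//; exact: ordge_const.
Qed.

(** Rotation multiplies a monomial matrix by a constant diagonal matrix, which
    is absorbed by the Iwahori. *)
Lemma rot_wpt (c : C) e n x : c != 0 ->
  Defs.rot c (wpt e n (umx x)) = wpt e n (umx (lrot c x)).
Proof.
move=> c0; rewrite /wpt rot_coset// lrot_mulmx//.
have -> : map_mx (lrot c) (wmx C e n) =
    mx2 (lconst (c ^ n)) 0 0 (lconst (c ^ (- n))) *m wmx C e n.
  rewrite /wmx; case: e; rewrite lrot_mx2 mulmx_mx2; congr mx2;
    by rewrite ?mul0r ?mulr0 ?addr0 ?add0r ?mulrN ?lrotN ?lrot0// lrot_monom lmonomM add0r.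
have -> : map_mx (lrot c) (umx x) = umx (lrot c x) by rewrite lrot_mx2 lrot0 lrot1.
rewrite mulmxA; apply: (wpt_mulr (det_umx _)).
apply: iwahori_conj_diag; rewrite ?lmonomM ?addr0 -?expfzDr ?subrr ?lmonom10//;
  exact: ordge_const.
Qed.

(** Such conditions on the coordinate cut out all the sets of positive index. *)
Definition jet P : set L := [set x | ordge 0 x /\ P (lcoef x 0) (lcoef x 1)].

Definition jet_rep (a b : C) : L := lconst a + lmonom b 1.

Lemma jet_rep_ordge a b : ordge 0 (jet_rep a b).
Proof. by apply: ordgeD; exact: ordge_monom. Qed.

Lemma jet_rep0 a b : lcoef (jet_rep a b) 0 = a.
Proof. by rewrite /= addr0. Qed.

Lemma jet_rep1 a b : lcoef (jet_rep a b) 1 = b.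
Proof. by rewrite /= add0r. Qed.

Lemma scaling_class_jet P a b :
  (forall a' b', P a' b' <->
     exists2 alpha : C, alpha != 0 & a' = alpha ^+ 2 * a /\ b' = alpha ^+ 2 * b) ->
  scaling_class (jet_rep a b) = jet P.
Proof.
move=> PE; apply/seteqP; split=> x [x0 xP]; split=> //.
  by apply/PE; move: xP; rewrite jet_rep0 jet_rep1.
by rewrite jet_rep0 jet_rep1; apply/PE.
Qed.

Lemma sqrt_scaling (a b : C) : a != 0 -> b != 0 ->
  exists2 alpha : C, alpha != 0 & b = alpha ^+ 2 * a.
Proof.
move=> a0 b0; exists (sqrtC (b / a)); last by rewrite sqrtCK divfK.
by rewrite sqrtC_eq0 mulf_neq0// invr_eq0.
Qed.

(** The conditions under which a single orbit results, named after the superscripts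
    of the sets of positive index; the sets of negative index use the last two in
    the lower chart. *)
Inductive orbit_type : (C -> C -> Prop) -> Prop :=
| Type_oh : orbit_type (fun a b => a != 0 /\ b = 0)
| Type_ho : orbit_type (fun a b => a = 0 /\ b != 0)
| Type_hh : orbit_type (fun a b => a = 0 /\ b = 0).

(** Each condition is a single scaling class because every nonzero complex
    number is a square. *)
Lemma orbit_type_scaling P : orbit_type P -> exists a b, forall a' b', P a' b' <->
  exists2 alpha : C, alpha != 0 & a' = alpha ^+ 2 * a /\ b' = alpha ^+ 2 * b.
Proof.
have sq1 (a : C) : a != 0 -> exists2 al : C, al != 0 & a = al ^+ 2 * 1.
  by apply: sqrt_scaling; exact: oner_neq0.
have sq0 (al : C) : al != 0 -> al ^+ 2 * 1 != 0 by move=> al0; rewrite mulr1 expf_neq0.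
case; [exists 1, 0|exists 0, 1|exists 0, 0] => a b; split.
- by move=> [/sq1[al al0 ->] ->]; exists al; rewrite ?mulr0.
- by move=> [al al0 [-> ->]]; rewrite mulr0; split=> //; exact: sq0.
- by move=> [-> /sq1[al al0 ->]]; exists al; rewrite ?mulr0.
- by move=> [al al0 [-> ->]]; rewrite mulr0; split=> //; exact: sq0.
- by move=> [-> ->]; exists 1; rewrite ?oner_neq0 ?mulr0.
- by move=> [al al0 [-> ->]]; rewrite mulr0.
Qed.

Lemma ucell_is_I4_orbit e n P : -1 <= level e n -> orbit_type P ->
  is_I4_orbit (ucell e n (jet P)).
Proof.
move=> lev /orbit_type_scaling[a [b PE]].
exists (wpt e n (umx (jet_rep a b))); first by apply: flag_wpt; rewrite det_umx.
by rewrite I4_orbit_ucell ?(scaling_class_jet PE)//; exact: jet_rep_ordge.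
Qed.

Lemma lcell_is_I4_orbit e n P : level e n <= 2 -> orbit_type P ->
  is_I4_orbit (lcell e n (jet P)).
Proof.
move=> lev /orbit_type_scaling[a [b PE]].
exists (wpt e n (lmx (jet_rep a b))); first by apply: flag_wpt; rewrite det_lmx.
by rewrite I4_orbit_lcell ?(scaling_class_jet PE)//; exact: jet_rep_ordge.
Qed.

(** Two pairs of nonzero coefficients differ by a scaling by a square, which fixes
    the constant term, followed by a rotation, which fixes the constant term and
    adjusts the other one. *)
Lemma ucell_is_I4rot_orbit e n : -1 <= level e n ->
  is_I4rot_orbit (ucell e n (jet (fun a b => a != 0 /\ b != 0))).
Proof.
move=> lev; exists (wpt e n (umx (jet_rep 1 1))).
  by apply: flag_wpt; rewrite det_umx.
have orbE (c : C) : c != 0 -> I4_orbit (Defs.rot c (wpt e n (umx (jet_rep 1 1)))) =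
    ucell e n (scaling_class (lrot c (jet_rep 1 1))).
  move=> c0; rewrite rot_wpt// I4_orbit_ucell//.
  by apply: ordge_lrot; exact: jet_rep_ordge.
have lrot0c (c : C) x : lcoef (lrot c x) 0 = lcoef x 0 by rewrite /= expr0z mul1r.
have lrot1c (c : C) x : lcoef (lrot c x) 1 = c * lcoef x 1 by [].
apply/seteqP; split=> X.
  move=> [x [x0 [a0 b0]] <-].
  have [al al0 aE] := sqrt_scaling (oner_neq0 _) a0.
  (* [I4] preserves the ratio of the two coefficients, which is 1 at the base
     point, so the rotation alone has to produce it. *)
  pose c := lcoef x 1 / lcoef x 0.
  have c0 : c != 0 by rewrite mulf_neq0// invr_eq0.
  have : I4_orbit (Defs.rot c (wpt e n (umx (jet_rep 1 1)))) (wpt e n (umx x)).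
    rewrite orbE//; exists x => //; split=> //; exists al => //.
    rewrite mulr1 in aE; rewrite lrot0c lrot1c jet_rep0 jet_rep1 !mulr1 -aE.
    by split=> //; rewrite mulrC divfK.
  by move=> [u Iu <-]; exists (u, c).
move=> [[u c] [/= Iu c0] <-].
have : I4_orbit (Defs.rot c (wpt e n (umx (jet_rep 1 1))))
    (lact u (Defs.rot c (wpt e n (umx (jet_rep 1 1))))) by exists u.
rewrite orbE// => -[x [x0 [al al0 [e0 e1]]] <-].
exists x => //; split=> //; rewrite e0 e1 lrot0c lrot1c jet_rep0 jet_rep1 !mulr1.
by split; rewrite ?mulf_neq0 ?expf_neq0.
Qed.

Definition ordeq (j : int) : set L := [set x | ordge j x /\ lcoef x j != 0].

(** The change of chart.  It comes from the Bruhat decomposition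
    [L(s) = U(x) (0, -x; s, 0) U(x)] for [x = s^-1]: the last factor is absorbed
    when [x] is in [t^m C[[t]]], and the antidiagonal factor turns the monomial
    matrix into one of the other parity, up to units. *)
Lemma wpt_lmx_umx e n (j : int) s x : s * x = 1 -> ordge j s -> ordge (- j) x ->
  level e n <= - j -> wpt e n (lmx s) = wpt (~~ e) (- n - j) (umx x).
Proof.
move=> sx sj xj lev.
have -> : lmx s = umx x *m mx2 0 (- x) s 0 *m umx x.
  by rewrite !mulmx_mx2; congr mx2; ring: sx.
have dx : \det (mx2 0 (- x) s 0) = 1 by rewrite det_mx2; ring: sx.
rewrite wpt_mulr; [|by rewrite det_mulmx det_umx dx mulr1|
  by apply/iwahori_conj_umx; exact: ordgeW xj].
(* The units left over once the antidiagonal factor has been merged into the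
   monomial matrix. *)
pose u := (-1) ^+ (~~ e) * (x * tpow C j).
pose v := (-1) ^+ (~~ e) * (s * tpow C (- j)).
have uv : u * v = 1.
  transitivity ((-1) ^+ (~~ e) * (-1) ^+ (~~ e) * (s * x) * (tpow C (- j) * tpow C j)).
    by rewrite /u /v; ring.
  by rewrite -signr_addb addbb sx tpowNK !mulr1.
rewrite /wpt -mulmxA.
have -> : mx2 0 (- x) s 0 *m wmx C e n = mx2 u 0 0 v *m wmx C (~~ e) (- n - j).
  have tpn : tpow C j * tpow C (- n - j) = tpow C (- n).
    by rewrite tpowD; congr tpow; lia.
  have tpm : tpow C (- j) * tpow C (- (- n - j)) = tpow C n.
    by rewrite tpowD; congr tpow; lia.
  rewrite /wmx /u /v; case: e {lev u v uv} => /=; rewrite !mulmx_mx2 -tpn -tpm; congr mx2;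
  by ring.
rewrite mulmxA; apply: (wpt_mulr (det_umx _)).
have sgn f : ordge 0 f -> ordge 0 ((-1) ^+ (~~ e) * f).
  by case: e {lev u v uv} => /=; rewrite ?expr0 ?expr1 ?mul1r ?mulN1r// => /ordgeN.
apply: iwahori_conj_diag => //; apply: sgn; rewrite mulrC; apply/ordge_tpowM.
  by rewrite sub0r.
by rewrite sub0r opprK.
Qed.

Lemma lcell_ordeq e n (j : int) : level e n <= - j ->
  lcell e n (ordeq j) = ucell (~~ e) (- n - j) (ordeq (- j)).
Proof.
move=> lev; apply/seteqP; split=> X.
  move=> [s [sj sj0] <-]; have [x [xj xj0 sx]] := linv_exists sj sj0.
  by exists x => //; rewrite (wpt_lmx_umx sx sj xj).
move=> [x [xj xj0] <-]; have [s [sj sj0 xs]] := linv_exists xj xj0.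
rewrite opprK in sj sj0; exists s => //.
by rewrite (@wpt_lmx_umx _ _ j s x)// mulrC.
Qed.

Lemma ordeq_exists (a b : int) s : ordge a s ->
  ordge b s \/ exists2 j : int, a <= j < b & ordeq j s.
Proof.
move=> sa; have [ba|ab] := leP b a; first by left; exact: ordgeW sa.
have -> : b = a + (absz (b - a))%:Z by lia.
elim: (absz _) => [|m [sm|[j jm sj]]]; first by left; rewrite addr0.
  have [sm0|sm0] := eqVneq (lcoef s (a + m%:Z)) 0; last first.
    by right; exists (a + m%:Z) => //; lia.
  left=> k km; have [km'|km'] := ltP k (a + m%:Z); first exact: sm.
  by have -> : k = a + m%:Z by lia.
by right; exists j => //; lia.
Qed.

(** A lower coordinate of order at least 2 either has a valuation below [1 - m],
    which puts it in one piece of the union, or is 0 modulo [t^(1-m)]. *)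
Lemma lcell_hh e n :
  \bigcup_(k in zrange 1 (- level e n - 1)) lcell e n (ordeq (k + 1)) `|`
  [set wpt e n (lmx 0)] = lcell e n (jet (fun a b => a = 0 /\ b = 0)).
Proof.
have jet2 s : ordge 2 s -> jet (fun a b => a = 0 /\ b = 0) s.
  by move=> s2; split; [exact: ordgeW s2|rewrite !s2].
apply/seteqP; split=> X.
  move=> [[k kr [s [sk _] <-]]|->].
    by exists s => //; apply: jet2; apply: ordgeW sk; move: kr; rewrite /zrange /=; lia.
  by exists 0 => //; exact: jet2.
move=> [s [s0 [a0 b0]] <-].
have s2 : ordge 2 s.
  move=> k k2; have [k0|k0] := ltP k 0; first exact: s0.
  by have [->|->] : k = 0 \/ k = 1 by lia.
have [sM|[j jr sj]] := ordeq_exists (1 - level e n) s2.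
  by right; apply/wpt_lmx_eq; rewrite subr0.
left; exists (j - 1); first by rewrite /zrange /=; lia.
by exists s => //; rewrite subrK.
Qed.

Definition brk e n p : set M := if e then bracket' n p else bracket n p.

Lemma brk_wpt e n p : brk e n p = wpt e n (umx ((-1) ^+ e * (tpow C n * p))).
Proof.
have t1 := tpowNK' C n.
rewrite /brk /wpt /wmx; case: e; congr coset; rewrite mulmx_mx2; congr mx2; try ring.
- by ring: t1.
- by ring: t1.
Qed.

Fact ltrunc_bounded (N : int) x : exists a : nat, forall k : int,
  k < - a%:Z -> (if k < N then lcoef x k else 0) = 0.
Proof. by have [a xa] := lcoef_bounded x; exists a => k /xa ->; rewrite if_same. Qed.

(** Since the chart sees [x] mod [t^m] only, truncation produces the Laurent
    polynomial representing a given point. *)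
Definition ltrunc N x : L := Laurent (ltrunc_bounded N x).

Lemma lcoef_sgn e x k : lcoef ((-1) ^+ e * x) k = (-1) ^+ e * lcoef x k.
Proof. by case: e; rewrite ?expr0 ?expr1 ?mul1r ?mulN1r. Qed.

(** Conditions on a Laurent polynomial become conditions on the coordinate, with
    exponents shifted by [n].  The top exponent allowed is the last one that the
    chart sees, so the terms above [lo] are free. *)
Lemma brk_lpols e n (U : set int) (lo hi : int) :
  hi + n + 1 = level e n -> lo <= hi + 1 -> (forall m, U m -> m < lo) ->
  brk e n @` lpols U (zrange lo hi) = ucell e n
    [set x | (forall i, U (i - n) -> lcoef x i != 0) /\
             (forall i, i < lo + n -> ~ U (i - n) -> lcoef x i = 0)].
Proof.
move=> hiE lohi Ulo.
have sgn0 (c : C) : ((-1) ^+ e * c == 0) = (c == 0) by rewrite mulf_eq0 signr_eq0.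
apply/seteqP; split=> X.
  move=> [p [pU pV] <-]; rewrite brk_wpt; eexists; [|reflexivity].
  split=> i iU; rewrite lcoef_sgn lcoef_tpowM ?sgn0; first exact: pU.
  move=> niU; apply/eqP; rewrite sgn0; apply/eqP/pV => //; rewrite /zrange /=.
  by move: iU; lia.
move=> [x [xU xV] <-].
pose p := (-1) ^+ e * (tpow C (- n) * ltrunc (level e n) x).
have pE m : lcoef p m = (-1) ^+ e * if m + n < level e n then lcoef x (m + n) else 0.
  by rewrite lcoef_sgn lcoef_tpowM opprK.
have pU m : U m -> lcoef p m != 0.
  move=> Um; rewrite pE sgn0 ifT; last by have := Ulo _ Um; lia.
  by apply: xU; rewrite addrK.
have pV m : ~ U m -> ~ zrange lo hi m -> lcoef p m = 0.
  move=> Um mV; have {}mV : ~ (lo <= m <= hi) := mV.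
  apply/eqP; rewrite pE sgn0; case: ifPn => // mn.
  by apply/eqP/xV; rewrite ?addrK//; move: mV; lia.
exists p => //.
rewrite brk_wpt; apply/wpt_umx_eq.
have -> : (-1) ^+ e * (tpow C n * p) = ltrunc (level e n) x.
  transitivity ((-1) ^+ e * (-1) ^+ e * (tpow C n * tpow C (- n)) * ltrunc (level e n) x).
    by rewrite /p; ring.
  by rewrite -signr_addb addbb tpowNK' !mul1r.
by move=> k klev; rewrite lcoefD lcoefN /= klev subrr.
Qed.

Lemma brk_jet e n (U : set int) (lo hi : int) P :
  hi + n + 1 = level e n -> lo <= hi + 1 -> (forall m, U m -> m < lo) ->
  (forall x, (forall i, U (i - n) -> lcoef x i != 0) /\
             (forall i, i < lo + n -> ~ U (i - n) -> lcoef x i = 0) <-> jet P x) ->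
  brk e n @` lpols U (zrange lo hi) = ucell e n (jet P).
Proof.
move=> hiE lohi Ulo UP; rewrite brk_lpols//; congr (ucell _ _ _).
by apply/seteqP; split=> x /UP.
Qed.

Lemma brk_o e n (hi : int) : hi + n + 1 = level e n -> - n <= hi ->
  brk e n @` lpols [set - n] (zrange (- n + 1) hi) = ucell e n (jet (fun a b => a != 0)).
Proof.
move=> hiE nhi; apply: brk_jet => // [|m ->|x]; [lia|lia|split=> [[xU xV]|[x0 a0]]].
  by split=> [k k0|]; [apply: xV => /=; lia|apply: xU => /=; lia].
split=> i iU; first by have -> : i = 0 by move: iU => /=; lia.
by move=> iV; apply: x0; move: iU iV => /=; lia.
Qed.

Lemma brk_oo e n (hi : int) : hi + n + 1 = level e n -> - n + 1 <= hi ->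
  brk e n @` lpols [set - n; - n + 1] (zrange (- n + 2) hi) =
  ucell e n (jet (fun a b => a != 0 /\ b != 0)).
Proof.
move=> hiE nhi; apply: brk_jet => // [|m [->|->]|x]; [lia|lia|lia|].
split=> [[xU xV]|[x0 [a0 b0]]].
  split=> [k k0|]; first by apply: xV => /=; lia.
  by split; apply: xU => /=; lia.
split=> i iU; last by move=> iV; apply: x0; move: iU iV => /=; lia.
by have [->|->] : i = 0 \/ i = 1 by move: iU => /=; lia.
Qed.

Lemma brk_oh e n (hi : int) : hi + n + 1 = level e n -> - n + 1 <= hi ->
  brk e n @` lpols [set - n] (zrange (- n + 2) hi) =
  ucell e n (jet (fun a b => a != 0 /\ b = 0)).
Proof.
move=> hiE nhi; apply: brk_jet => // [|m ->|x]; [lia|lia|].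
split=> [[xU xV]|[x0 [a0 b0]]].
  split=> [k k0|]; first by apply: xV => /=; lia.
  by split; [apply: xU|apply: xV] => /=; lia.
split=> i iU; first by have -> : i = 0 by move: iU => /=; lia.
move=> iV; have [i0|i0] := ltP i 0; first exact: x0.
by have -> : i = 1 by move: iU iV => /=; lia.
Qed.

Lemma brk_ho e n (hi : int) : hi + n + 1 = level e n -> - n + 1 <= hi ->
  brk e n @` lpols [set - n + 1] (zrange (- n + 2) hi) =
  ucell e n (jet (fun a b => a = 0 /\ b != 0)).
Proof.
move=> hiE nhi; apply: brk_jet => // [|m ->|x]; [lia|lia|].
split=> [[xU xV]|[x0 [a0 b0]]].
  split=> [k k0|]; first by apply: xV => /=; lia.
  by split; [apply: xV|apply: xU] => /=; lia.
split=> i iU; first by have -> : i = 1 by move: iU => /=; lia.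
move=> iV; have [i0|i0] := ltP i 0; first exact: x0.
by have -> : i = 0 by move: iU iV => /=; lia.
Qed.

Lemma brk_hh e n (hi : int) : hi + n + 1 = level e n -> - n + 1 <= hi ->
  brk e n @` lpols set0 (zrange (- n + 2) hi) =
  ucell e n (jet (fun a b => a = 0 /\ b = 0)).
Proof.
move=> hiE nhi; apply: brk_jet => // [|x]; [lia|].
split=> [[xU xV]|[x0 [a0 b0]]].
  split=> [k k0|]; first by apply: xV => //; lia.
  by split; apply: xV => //; lia.
split=> i // iU _; have [i0|i0] := ltP i 0; first exact: x0.
by have [->|->] : i = 0 \/ i = 1 by move: iU; lia.
Qed.

(** Seen in the lower chart of the other parity, the pieces of the sets of
    negative index are given by a valuation. *)
Lemma brk_ordeq e n (j hi : int) : hi - n - j + 1 = level (~~ e) (- n - j) ->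
  level e n <= - j ->
  brk (~~ e) (- n - j) @` lpols [set n] (zrange (n + 1) hi) = lcell e n (ordeq j).
Proof.
move=> hiE lev; rewrite lcell_ordeq// brk_lpols; first last.
- by move=> m ->; lia.
- by move: hiE lev; rewrite /level; case: e => /=; lia.
- by rewrite -hiE; lia.
congr (ucell _ _ _); apply/seteqP; split=> x [xU xV].
  split; last by apply: xU => /=; lia.
  by move=> k kj; apply: xV => /=; lia.
split=> i iU; first by have -> : i = - j by move: iU => /=; lia.
by move=> iV; apply: xU; move: iU iV => /=; lia.
Qed.

End Orbits.

(** * Polynomial functions *)
Section Polyfun.
Variables (K : fieldType) (T J : Type) (x : J -> T -> K).

Lemma polyfun_ext (f g : T -> K) : f =1 g -> polyfun x f -> polyfun x g.
Proof. by move=> /funext ->. Qed.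

Lemma polyfunZ c f : polyfun x f -> polyfun x (fun a => c * f a).
Proof. by move=> xf; apply: polyfun_mul => //; exact: polyfun_cst. Qed.

Lemma polyfunB f g : polyfun x f -> polyfun x g -> polyfun x (fun a => f a - g a).
Proof.
move=> xf xg; apply: polyfun_add => //.
by apply: (@polyfun_ext (fun a => -1 * g a)) (polyfunZ _ _) => // a; rewrite mulN1r.
Qed.

Lemma polyfun_sum (I : Type) (r : seq I) (F : I -> T -> K) :
  (forall i, polyfun x (F i)) -> polyfun x (fun a => \sum_(i <- r) F i a).
Proof.
move=> xF; elim: r => [|i r IH].
  by apply: polyfun_ext (polyfun_cst _ 0) => a; rewrite big_nil.
by apply: polyfun_ext (polyfun_add (xF i) IH) => a; rewrite big_cons.
Qed.

Lemma polyfunX f n : polyfun x f -> polyfun x (fun a => f a ^+ n).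
Proof.
move=> xf; elim: n => [|n IH].
  by apply: polyfun_ext (polyfun_cst _ 1) => a; rewrite expr0.
by apply: polyfun_ext (polyfun_mul xf IH) => a; rewrite exprS.
Qed.

Lemma regular_polyfun (X : set T) f : polyfun x f -> regular_on x X f.
Proof.
move=> xf a _; exists f, (fun=> 1); split=> //; first exact: polyfun_cst.
  exact: oner_neq0.
by move=> b _ _; rewrite divr1.
Qed.

End Polyfun.

(** * The open cell inside a closed set *)
Section BigCell.
Variable R : realType.
Local Notation C := R[i].
Local Notation L := (laurent C).
Local Notation M := 'M[L]_2.
Implicit Types (x y : L) (g h k : M) (n m : int) (e : bool) (P : C -> C -> Prop).

(** Products with such a series only shift and scale coefficients, which is why
    twisting by a monomial matrix preserves polynomiality. *)
Definition monomial_series (f : L) := exists c q, f = lmonom c q.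

Lemma monomial_series0 : monomial_series 0.
Proof. by exists 0, 0; apply: laurentP => k /=; case: ifP. Qed.

Lemma monomial_seriesN f : monomial_series f -> monomial_series (- f).
Proof.
move=> [c [q ->]]; exists (- c), q; apply: laurentP => k /=.
by case: ifP; rewrite ?oppr0.
Qed.

Lemma monomial_series_tpow q : monomial_series (tpow C q).
Proof. by exists 1, q. Qed.

Lemma wmx_monomial e n i j : monomial_series (wmx C e n i j).
Proof.
have := (monomial_series0, monomial_seriesN, monomial_series_tpow) => -[[m0 mN] mt].
by rewrite /wmx; case: e; rewrite mxE; case: (i == 0); case: (j == 0); auto.
Qed.

Lemma adj2_wmx_monomial e n i j : monomial_series (adj2 (wmx C e n) i j).
Proof.
by rewrite mxE; case: (i == 0); case: (j == 0);
  do ?apply: monomial_seriesN; exact: wmx_monomial.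
Qed.

Definition untwist e n g := g *m adj2 (wmx C e n).

Lemma untwistK e n g : untwist e n g *m wmx C e n = g.
Proof. by rewrite -mulmxA mul_adj2mx ?det_wmx// mulmx1. Qed.

Lemma det_untwist e n g : \det g = 1 -> \det (untwist e n g) = 1.
Proof. by move=> dg; rewrite det_mulmx det_adj2 det_wmx dg mulr1. Qed.

Lemma coset_untwist e n g : coset g = wpt e n (untwist e n g).
Proof. by rewrite /wpt untwistK. Qed.

Lemma polyfun_untwist e n i j (q : int) :
  polyfun (@entry_coef R) (fun g => lcoef (untwist e n g i j) q).
Proof.
have [c0 [q0 E0]] := adj2_wmx_monomial e n 0 j.
have [c1 [q1 E1]] := adj2_wmx_monomial e n 1 j.
have coordP a (q' : int) : polyfun (@entry_coef R) (fun g => lcoef (g i a) q').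
  exact: (polyfun_coord (@entry_coef R) (i, a, q')).
apply: (polyfun_ext _ (polyfun_add (polyfunZ c0 (coordP 0 (q - q0)))
                                   (polyfunZ c1 (coordP 1 (q - q1))))) => g.
rewrite mxE !big_ord_recl big_ord0 addr0.
have -> : lift ord0 ord0 = 1 :> 'I_2 by apply/val_inj.
by rewrite E0 E1 lcoefD ![_ * lmonom _ _]mulrC !lcoef_monomM.
Qed.

(** For [m >= 0], a set of matrices containing all [U(x)] with [x] a power series,
    defined by vanishing of coefficients, and stable under right multiplication by
    [iwahori_conj m] ([bigcell_mulr]). *)
Definition bigcell m : set M := [set k | [/\ ordge (- m) (k 0 0), ordge 0 (k 0 1),
  ordge (1 - m) (k 1 0) & ordge 0 (k 1 1)]].

Lemma bigcell_mulr m k h : bigcell m k -> iwahori_conj m h -> bigcell m (k *m h).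
Proof.
move=> [k0 k1 k2 k3] [_ [h0 h1 h2 h3]].
rewrite [_ *m _]mx2_eta (mx2_eta k) (mx2_eta h) mulmx_mx2 /bigcell /= !mx2E.
split; apply: ordgeD.
- by rewrite -[- m]addr0; exact: ordgeM.
- by apply: (@ordgeW _ _ (0 + (1 - m))); [lia|exact: ordgeM].
- by rewrite -[0](addNr m); exact: ordgeM.
- exact: ordgeM0.
- by rewrite -[1 - m]addr0; exact: ordgeM.
- by rewrite -[1 - m]add0r; exact: ordgeM.
- by apply: (@ordgeW _ _ (1 - m + m)); [lia|exact: ordgeM].
- exact: ordgeM0.
Qed.

(** How to read off the coordinate [x]: right multiplication by
    [iwahori_conj m] rescales the second column [(k_01, k_11)] by a unit, modulo
    smaller terms, so [x] is their quotient mod [t^m]. *)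
Lemma wpt_umxP e n k x : \det k = 1 -> ordge 0 x -> 1 <= level e n ->
  wpt e n k = wpt e n (umx x) <->
  [/\ bigcell (level e n) k, lcoef (k 1 1) 0 != 0 &
      ordge (level e n) (k 0 1 - x * k 1 1)].
Proof.
move=> dk x0 lev; rewrite wpt_eqP ?det_umx//; set m := level e n in lev *.
have -> : adj2 (umx x) *m k =
    mx2 (k 0 0 - x * k 1 0) (k 0 1 - x * k 1 1) (k 1 0) (k 1 1).
  by rewrite {1}(mx2_eta k) adj2_mx2 mulmx_mx2; congr mx2; ring.
have dk' : (k 0 0 - x * k 1 0) * k 1 1 - (k 0 1 - x * k 1 1) * k 1 0 = 1.
  by move: dk; rewrite {1}(mx2_eta k) det_mx2 => <-; ring.
have xm i (f : L) : ordge i f -> ordge i (x * f).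
  by move=> /(ordgeM x0); rewrite add0r.
have small (f f' : L) : ordge m f -> ordge (1 - m) f' -> ordge 1 (f * f').
  by move=> fm gm; apply: (@ordgeW _ _ (m + (1 - m))); [lia|exact: ordgeM].
rewrite iwahori_conj_mx2; split=> [[_ [h0 h1 h2 h3]]|[[k0 k1 k2 k3] k30 h1]].
  split=> //.
    split=> //.
    - have -> : k 0 0 = (k 0 0 - x * k 1 0) + x * k 1 0 by ring.
      apply: ordgeD; first by apply: ordgeW h0; lia.
      by apply: xm; apply: ordgeW h2; lia.
    - have -> : k 0 1 = (k 0 1 - x * k 1 1) + x * k 1 1 by ring.
      by apply: ordgeD; [apply: ordgeW h1; lia|exact: xm].
  have := congr1 (fun f => lcoef f 0) dk'.
  rewrite lcoefD lcoefN lcoefM00// small// subr0 => dk0.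
  by apply/eqP => k30; move/eqP: dk0; rewrite k30 mulr0 eq_sym oner_eq0.
split=> //; split=> //.
(* The remaining corner is integral because the determinant is 1 and [k_11] is a
   unit. *)
have [v [v0 _ kv]] := linv_exists k3 k30.
have -> : k 0 0 - x * k 1 0 = (1 + (k 0 1 - x * k 1 1) * k 1 0) * v.
  by rewrite -[in 1 + _]dk' subrK -mulrA kv mulr1.
rewrite oppr0 in v0; apply: ordgeM0 => //.
apply: ordgeD; first exact: ordge1.
by apply: (@ordgeW _ _ 1) => //; exact: small.
Qed.

Definition bigcell_flags e n : set (set M) :=
  [set wpt e n k | k in [set k | \det k = 1 /\ bigcell (level e n) k]].

Lemma bigcell_flagsP e n k : \det k = 1 ->
  bigcell_flags e n (wpt e n k) <-> bigcell (level e n) k.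
Proof.
move=> dk; split=> [[h [dh bh]]|bk]; last by exists k.
move=> /esym/(wpt_eqP e n dk dh) I_hk.
have -> : k = h *m (adj2 h *m k) by rewrite mulmxA mulmx_adj2// mul1mx.
exact: bigcell_mulr.
Qed.

Lemma ucell_bigcell_flags e n P : 1 <= level e n ->
  ucell e n (jet P) `<=` bigcell_flags e n.
Proof.
move=> lev X [x [x0 _] <-]; apply/bigcell_flagsP; first exact: det_umx.
by have [] := (wpt_umxP (det_umx x) x0 lev).1 erefl.
Qed.

Lemma jet_eqs (m : int) (b d x : L) : 2 <= m -> ordge 0 d -> ordge 0 x ->
  ordge m (b - x * d) ->
  lcoef b 0 = lcoef x 0 * lcoef d 0 /\
  lcoef b 1 = lcoef x 0 * lcoef d 1 + lcoef x 1 * lcoef d 0.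
Proof.
move=> m2 d0 x0 bm; rewrite -lcoefM00// -lcoefM01//.
by split; apply/eqP; rewrite -subr_eq0 -lcoefN -lcoefD bm//; lia.
Qed.

(** A function [T] of the two lowest coefficients of numerator and denominator
    of [x] that is nonzero exactly on the cell cut out by [P]; it has to vanish
    with the denominator, that is, outside the chart. *)
Definition jet_test P (T : C -> C -> C -> C -> C) :=
  (forall b0 b1 d1 : C, T b0 b1 0 d1 = 0) /\
  (forall x0 x1 d0 d1 : C, d0 != 0 ->
     P x0 x1 <-> T (x0 * d0) (x0 * d1 + x1 * d0) d0 d1 != 0).

Definition eval_test (T : C -> C -> C -> C -> C) k : C :=
  T (lcoef (k 0 1) 0) (lcoef (k 0 1) 1) (lcoef (k 1 1) 0) (lcoef (k 1 1) 1).

Lemma ucell_testP e n P T k : jet_test P T -> 2 <= level e n -> \det k = 1 ->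
  bigcell (level e n) k ->
  ucell e n (jet P) (wpt e n k) <-> eval_test T k != 0.
Proof.
move=> [T0 TP] lev dk bk; have lev1 : 1 <= level e n by lia.
have [k0 k1 k2 k3] := bk; split.
  move=> [x [x0 Px] /esym/(wpt_umxP dk x0 lev1)[_ d0 xk]].
  by have [b0 b1] := jet_eqs lev k3 x0 xk; rewrite /eval_test b0 b1; apply/TP.
move=> Tk; have d0 : lcoef (k 1 1) 0 != 0.
  by apply: contraNneq Tk => d0; rewrite /eval_test d0 T0.
have [x x0 xk] := ldiv_exists k3 d0 k1.
have xk0 : ordge (level e n) (k 0 1 - x * k 1 1) by rewrite xk subrr.
exists x; last by apply/esym/(wpt_umxP dk x0 lev1).
have [b0 b1] := jet_eqs lev k3 x0 xk0.
by split=> //; apply/(TP _ _ _ (lcoef (k 1 1) 1) d0); rewrite -b0 -b1.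
Qed.

Definition cell_compl e n P := bigcell_flags e n `\` ucell e n (jet P).

(** Defining equations: the vanishing coefficients of [bigcell], together with the
    test function. *)
Lemma flag_closed_compl e n P T : jet_test P T -> 2 <= level e n ->
  polyfun (@entry_coef R) (fun g => eval_test T (untwist e n g)) ->
  flag_closed (cell_compl e n P).
Proof.
move=> TP lev Tpoly; split.
  by move=> X [[k [dk _] <-] _]; exact: flag_wpt.
move=> N; pose lo i j : int := mx2 (- level e n) 0 (1 - level e n) 0 i j.
pose F0 : set (M -> C) := [set f | exists i j (q : int), q < lo i j /\
  f = (fun g => lcoef (untwist e n g i j) q)].
exists (F0 `|` [set (fun g => eval_test T (untwist e n g))]); split.
  by move=> f [[i [j [q [_ ->]]]]|->//]; exact: polyfun_untwist.
move=> g dg _; have dk := det_untwist e n dg; rewrite (coset_untwist e n).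
set k := untwist e n g in dk *.
have F0P : bigcell (level e n) k <-> forall f, F0 f -> f g = 0.
  split=> [[k0 k1 k2 k3] _ [i [j [q [qlo ->]]]]|F0g].
    move: qlo; rewrite /lo mxE -/k.
    case: i => [[|[|i]] Hi] //; case: j => [[|[|j]] Hj] //= qlo.
    - have -> : Ordinal Hi = 0 by apply/val_inj.
      have -> : Ordinal Hj = 0 by apply/val_inj.
      exact: k0.
    - have -> : Ordinal Hi = 0 by apply/val_inj.
      have -> : Ordinal Hj = 1 by apply/val_inj.
      exact: k1.
    - have -> : Ordinal Hi = 1 by apply/val_inj.
      have -> : Ordinal Hj = 0 by apply/val_inj.
      exact: k2.
    - have -> : Ordinal Hi = 1 by apply/val_inj.
      have -> : Ordinal Hj = 1 by apply/val_inj.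
      exact: k3.
  have lok i j : ordge (lo i j) (k i j).
    by move=> q qlo; apply: (F0g (fun g => lcoef (untwist e n g i j) q)); exists i, j, q.
  have := (lok 0 0, lok 0 1, lok 1 0, lok 1 1); rewrite /lo !mx2E.
  by move=> [[[? ?] ?] ?].
split=> [[/(bigcell_flagsP _ _ dk) bk nP] f [Ff|->]|Fg].
- by move: f Ff; apply/F0P.
- apply/eqP; apply/negPn/negP => Tk; apply: nP.
  exact/(ucell_testP TP lev dk bk).
have bk : bigcell (level e n) k by apply/F0P => f Ff; apply: Fg; left.
split; first exact/bigcell_flagsP.
move=> /(ucell_testP TP lev dk bk) /eqP; apply.
by apply: (Fg (fun g => eval_test T (untwist e n g))); right.
Qed.

End BigCell.

(** * Local closedness and isomorphisms with products of affine spaces and tori *)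
Section Isomorphism.
Variable R : realType.
Local Notation C := R[i].
Local Notation L := (laurent C).
Local Notation M := 'M[L]_2.
Implicit Types (x y : L) (g h k : M) (n m : int) (e : bool) (P : C -> C -> Prop).

Lemma jet_test_False : jet_test (fun _ _ : C => False) (fun _ _ _ _ => 0).
Proof. by split=> // x0 x1 d0 d1 _; rewrite eqxx. Qed.

Lemma jet_test_o : jet_test (fun a b : C => a != 0) (fun b0 b1 d0 d1 => d0 * b0).
Proof.
split=> [b0 b1 d1|x0 x1 d0 d1 d00]; first by rewrite mul0r.
by rewrite !mulf_eq0 (negPf d00) orbF.
Qed.

Lemma jet_test_1 : jet_test (fun a b : C => b != 0)
  (fun b0 b1 d0 d1 => d0 * (b1 * d0 - b0 * d1)).
Proof.
split=> [b0 b1 d1|x0 x1 d0 d1 d00]; first by rewrite mul0r.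
have -> : (x0 * d1 + x1 * d0) * d0 - x0 * d0 * d1 = x1 * (d0 * d0) by ring.
by rewrite !mulf_eq0 (negPf d00) !orbF.
Qed.

Lemma jet_test_oo : jet_test (fun a b : C => a != 0 /\ b != 0)
  (fun b0 b1 d0 d1 => d0 * b0 * (b1 * d0 - b0 * d1)).
Proof.
split=> [b0 b1 d1|x0 x1 d0 d1 d00]; first by rewrite !mul0r.
have -> : (x0 * d1 + x1 * d0) * d0 - x0 * d0 * d1 = x1 * (d0 * d0) by ring.
rewrite !mulf_eq0 (negPf d00) !orbF !negb_or.
by split=> [[-> ->]|/andP[-> ->]].
Qed.

Lemma ucell_jet_False e n : ucell e n (jet (fun _ _ : C => False)) = set0.
Proof. by apply/seteqP; split=> X // [x [_ []]]. Qed.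

Lemma locally_closed_oo e n : 2 <= level e n ->
  flag_locally_closed (ucell e n (jet (fun a b : C => a != 0 /\ b != 0))).
Proof.
move=> lev; exists (cell_compl e n (fun _ _ => False)).
exists (cell_compl e n (fun a b => a != 0 /\ b != 0)); split.
- by apply: (flag_closed_compl jet_test_False) => //; exact: polyfun_cst.
- apply: (flag_closed_compl jet_test_oo) => //.
  by apply: polyfun_mul; [apply: polyfun_mul|apply: polyfunB; apply: polyfun_mul];
    exact: polyfun_untwist.
rewrite /cell_compl ucell_jet_False setD0 setDD; apply/esym/setIidr.
by apply: ucell_bigcell_flags; lia.
Qed.

(** The cell is the intersection of the open condition on the constant term with
    the closed condition that the next coefficient does not leave 0. *)
Lemma locally_closed_oh e n : 2 <= level e n ->
  flag_locally_closed (ucell e n (jet (fun a b : C => a != 0 /\ b = 0))).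
Proof.
move=> lev; exists (cell_compl e n (fun a b => b != 0)).
exists (cell_compl e n (fun a b => a != 0)); split.
- apply: (flag_closed_compl jet_test_1) => //.
  by apply: polyfun_mul; [|apply: polyfunB; apply: polyfun_mul];
    exact: polyfun_untwist.
- apply: (flag_closed_compl jet_test_o) => //.
  by apply: polyfun_mul; exact: polyfun_untwist.
have lev1 : 1 <= level e n by lia.
apply/seteqP; split=> X.
  move=> [x [x0 [a0 b0]] <-]; split; last by move=> [_]; apply; exists x.
  split; first by apply: (ucell_bigcell_flags (P := fun _ _ => True) lev1); exists x.
  move=> [y [y0 b1] /wpt_umx_eq yx].
  move/eqP: b1; apply; apply/eqP; rewrite -[_ == _]/(_ == _) -b0 -subr_eq0.
  by rewrite -lcoefN -lcoefD yx//; lia.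
move=> [[bX nX] nX'].
have [x [x0 a0] xX] : ucell e n (jet (fun a b : C => a != 0)) X.
  by apply: contrapT => nXo; apply: nX'.
exists x => //; split=> //; split=> //.
by apply/eqP; apply/negPn/negP => b0; apply: nX; exists x.
Qed.

Section Parametrization.
Variables (d : nat) (f : 'I_d -> nat).
Hypothesis f_inj : injective f.
Implicit Types (v w : 'rV[C]_d).

Definition param v : L := \sum_i lmonom (v 0 i) (f i)%:Z.

Lemma lcoef_param v (q : int) :
  lcoef (param v) q = \sum_i if q == (f i)%:Z then v 0 i else 0.
Proof. by rewrite lcoef_sum. Qed.

Lemma lcoef_param_f v i : lcoef (param v) (f i) = v 0 i.
Proof.
rewrite lcoef_param (bigD1 i)//= eqxx big1 ?addr0// => j ji.
by rewrite eqz_nat (inj_eq f_inj) eq_sym (negPf ji).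
Qed.

Lemma lcoef_param_notin v (q : int) : (forall i, q != f i) -> lcoef (param v) q = 0.
Proof. by move=> qf; rewrite lcoef_param big1// => i _; rewrite (negPf (qf i)). Qed.

Lemma param_ordge v : ordge 0 (param v).
Proof. by move=> q q0; apply: lcoef_param_notin => i; apply/eqP; lia. Qed.

Lemma polyfun_param (q : int) : polyfun (@row_coord R d) (fun v => lcoef (param v) q).
Proof.
have term_poly i : polyfun (@row_coord R d) (fun v => if q == (f i)%:Z then v 0 i else 0).
  by case: (q == _); [exact: (polyfun_coord (@row_coord R d) i)|exact: polyfun_cst].
apply: polyfun_ext (polyfun_sum (index_enum 'I_d) term_poly) => v.
by rewrite lcoef_param.
Qed.

Lemma polyfun_umx_param e n i j (q : int) :
  polyfun (@row_coord R d) (fun v => lcoef ((umx (param v) *m wmx C e n) i j) q).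
Proof.
have [c0 [q0 E0]] := wmx_monomial R e n 0 j.
have [c1 [q1 E1]] := wmx_monomial R e n 1 j.
have umxP a (q' : int) : polyfun (@row_coord R d) (fun v => lcoef (umx (param v) i a) q').
  case: (boolP (i == 0)) => i0; case: (boolP (a == 0)) => a0.
  - apply: (polyfun_ext _ (polyfun_cst _ (lcoef (1 : L) q'))) => v.
    by rewrite mxE i0 a0.
  - by apply: (polyfun_ext _ (polyfun_param q')) => v; rewrite mxE i0 (negPf a0).
  - by apply: (polyfun_ext _ (polyfun_cst _ 0)) => v; rewrite mxE (negPf i0) a0.
  - apply: (polyfun_ext _ (polyfun_cst _ (lcoef (1 : L) q'))) => v.
    by rewrite mxE (negPf i0) (negPf a0).
apply: (polyfun_ext _ (polyfun_add (polyfunZ c0 (umxP 0 (q - q0)))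
                                   (polyfunZ c1 (umxP 1 (q - q1))))) => v.
rewrite [in RHS]mxE !big_ord_recl big_ord0 addr0.
have -> : lift ord0 ord0 = 1 :> 'I_2 by apply/val_inj.
by rewrite E0 E1 lcoefD ![_ * lmonom _ _]mulrC !lcoef_monomM.
Qed.

(** By [wpt_umxP], these are the relations between [k] and the coordinate [x] of
    its point that the recursive formula for the quotient uses. *)
Definition quo_domain m k x :=
  [/\ ordge 0 (k 0 1), ordge 0 (k 1 1), ordge 0 x, lcoef (k 1 1) 0 != 0 &
      ordge m (k 0 1 - x * k 1 1)].

(** Coefficients of a quotient of power series, by the recursion for long
    division; each step costs one more power of the constant term of the
    denominator. *)
Lemma quo_coef_polyfun e n (i : nat) : exists2 Q, polyfun (@entry_coef R) Q &
  forall g x, quo_domain (level e n) (untwist e n g) x -> i%:Z < level e n ->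
    lcoef x i * lcoef (untwist e n g 1 1) 0 ^+ i.+1 = Q g.
Proof.
elim/ltn_ind: i => i IH.
have /fin_all_exists2[Q Qpoly QE] : forall j : 'I_i, exists2 Q : M -> C,
    polyfun (@entry_coef R) Q &
    forall g x, quo_domain (level e n) (untwist e n g) x -> j%:Z < level e n ->
      lcoef x j * lcoef (untwist e n g 1 1) 0 ^+ j.+1 = Q g.
  by move=> j; exact: IH.
pose b q g := lcoef (untwist e n g 0 1) q.
pose c q g := lcoef (untwist e n g 1 1) q.
exists (fun g => b i g * c 0 g ^+ i -
  \sum_(j < i) Q j g * (c 0 g ^+ (i - j.+1)%N * c (i - j)%N g)).
  apply: polyfunB.
    by apply: polyfun_mul; [|apply: polyfunX]; exact: polyfun_untwist.
  apply: polyfun_sum => j; apply: polyfun_mul => //.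
  by apply: polyfun_mul; [apply: polyfunX|]; exact: polyfun_untwist.
move=> g x dom ilev; have [k1 k3 x0 d0 xk] := dom.
have bE : b i g = \sum_(j < i.+1) lcoef x j * c (i - j)%N g.
  by rewrite -lcoefM0//; apply/eqP; rewrite -subr_eq0 -lcoefN -lcoefD xk.
rewrite bE big_ord_recr /= subnn mulrDl mulr_suml.
rewrite [X in X + _ - _](eq_bigr (fun j : 'I_i =>
    Q j g * (c 0 g ^+ (i - j.+1)%N * c (i - j)%N g))); last first.
  move=> j _; rewrite -(QE j g x)//; last by apply: lt_trans ilev; rewrite ltz_nat.
  rewrite -[lcoef (untwist e n g 1 1) 0]/(c 0 g).
  have -> : c 0 g ^+ i = c 0 g ^+ j.+1 * c 0 g ^+ (i - j.+1)%N.
    by rewrite -exprD subnKC.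
  by ring.
by rewrite addrAC subrr add0r exprS mulrA.
Qed.

Definition param_pt e n v : set M := wpt e n (umx (param v)).

(** The parametrization is polynomial by construction and injective because the
    chart determines the coefficients of [x] below [t^m]; its inverse is regular
    by [quo_coef_polyfun]. *)
Lemma param_pt_isomorphic e n P (V : set 'rV[C]_d) :
  (forall i, (f i)%:Z < level e n) -> 1 <= level e n ->
  (forall v, V v -> P (lcoef (param v) 0) (lcoef (param v) 1)) ->
  (forall x, jet P x -> exists2 v, V v & ordge (level e n) (x - param v)) ->
  flag_locally_closed (ucell e n (jet P)) ->
  flag_isomorphic (ucell e n (jet P)) V.
Proof.
move=> flev lev VP PV lc; split=> //.
have imE : param_pt e n @` V = ucell e n (jet P).
  apply/seteqP; split=> X.
    by move=> [v Vv <-]; exists (param v) => //; split; [exact: param_ordge|exact: VP].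
  move=> [x /PV[v Vv xv] <-]; exists v; first exact: Vv.
  by apply/esym/wpt_umx_eq.
have pt_inj v w : param_pt e n v = param_pt e n w -> v = w.
  move=> /wpt_umx_eq vw; apply/rowP => i; apply/eqP; rewrite -subr_eq0.
  by rewrite -!lcoef_param_f -lcoefN -lcoefD vw.
pose psi X : 'rV[C]_d := xget 0 [set v | param_pt e n v = X].
have psiK v : psi (param_pt e n v) = v.
  pose S : set 'rV[C]_d := [set w | param_pt e n w = param_pt e n v].
  exact: pt_inj (@xgetI _ 0 S v erefl).
exists (param_pt e n), psi; split => //.
- move=> v Vv; exists (fun=> 1); split; [exact: polyfun_cst|exact: oner_neq0|].
  exists (fun w => umx (param w) *m wmx C e n), (absz n); split.
    move=> w _ _; split=> //.
      by rewrite /SL2 /= det_mulmx det_umx det_wmx mulr1.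
    have t0 : ordge (- (absz n)%:Z) (0 : L) by exact: ordge0.
    have tn : ordge (- (absz n)%:Z) (tpow C n) by apply: ordge_monom; lia.
    have tm : ordge (- (absz n)%:Z) (tpow C (- n)) by apply: ordge_monom; lia.
    have px y : ordge (- (absz n)%:Z) y -> ordge (- (absz n)%:Z) (param w * y).
      by move=> /(ordgeM (param_ordge w)); rewrite add0r.
    move=> i j; rewrite /wmx; case: e {flev lev PV lc imE pt_inj psi psiK VP v Vv};
    rewrite mulmx_mx2 mxE !mul0r !mulr0 !mul1r ?add0r ?addr0;
    case: (i == 0); case: (j == 0) => //; do ?apply: ordgeN; auto.
      by rewrite mulrN; exact/ordgeN/px.
    exact: px.
  by move=> [[i j] q]; apply: regular_polyfun; exact: polyfun_umx_param.
move=> j N g [[dg _] Sg].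
have [Q Qpoly QE] := quo_coef_polyfun e n (f j).
exists Q, (fun g => lcoef (untwist e n g 1 1) 0 ^+ (f j).+1).
have domP h : SL2 h -> ucell e n (jet P) (coset h) -> exists2 v,
    quo_domain (level e n) (untwist e n h) (param v) & coset h = param_pt e n v.
  move=> dh; rewrite -imE => -[v Vv vh]; exists v => //.
  move: vh; rewrite (coset_untwist e n) => /esym/(wpt_umxP _ (param_ordge v) lev).
  case; first exact: det_untwist.
  by move=> [_ k1 _ k3] d0 xk; split=> //; exact: param_ordge.
split => //.
- by apply: polyfunX; exact: polyfun_untwist.
- by have [v [_ _ _ d0 _] _] := domP g dg Sg; rewrite expf_neq0.
move=> h [[dh _] Sh] d0; have [v dom hv] := domP h dh Sh.
apply/eqP; rewrite eq_sym -(QE h _ dom (flev j)) mulfK// lcoef_param_f.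
by rewrite /= hv psiK.
Qed.

End Parametrization.

Lemma ucell_oo_isomorphic e n (b : nat) : level e n = (2 + b)%N%:Z ->
  flag_isomorphic (ucell e n (jet (fun a b : C => a != 0 /\ b != 0))) (Gm_affine R 2 b).
Proof.
move=> lev; have f_inj : injective (fun i : 'I_(2 + b) => i : nat) by exact: val_inj.
pose i0 : 'I_2 := 0; pose i1 : 'I_2 := 1.
have par0 v : lcoef (param (fun i : 'I_(2 + b) => i : nat) v) 0 = v 0 (lshift b i0).
  exact: (lcoef_param_f f_inj v (lshift b i0)).
have par1 v : lcoef (param (fun i : 'I_(2 + b) => i : nat) v) 1 = v 0 (lshift b i1).
  exact: (lcoef_param_f f_inj v (lshift b i1)).
apply: (param_pt_isomorphic f_inj).
- by move=> i; rewrite lev ltz_nat.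
- by rewrite lev; lia.
- by move=> v Vv; rewrite par0 par1; split; exact: Vv.
- move=> x [x0 [a0 b0]]; pose v : 'rV[C]_(2 + b) := \row_i lcoef x (i : nat).
  have xv : ordge (level e n) (x - param (fun i : 'I_(2 + b) => i : nat) v).
    move=> q; rewrite lev => qlev; rewrite lcoefD lcoefN.
    have [q0|q0] := ltP q 0; first by rewrite x0// param_ordge// subrr.
    have qb : (absz q < 2 + b)%N by lia.
    have -> : q = (Ordinal qb : nat)%:Z by rewrite /=; lia.
    by rewrite (lcoef_param_f f_inj v (Ordinal qb)) mxE subrr.
  exists v => // i; rewrite mxE /=.
  by case: i => [[|[|i]] Hi].
- by apply: locally_closed_oo; rewrite lev; lia.
Qed.

(** Here the coordinate [x] has all exponents but [1], enumerated by [bump 1]. *)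
Lemma ucell_oh_isomorphic e n (b : nat) : level e n = (2 + b)%N%:Z ->
  flag_isomorphic (ucell e n (jet (fun a b : C => a != 0 /\ b = 0))) (Gm_affine R 1 b).
Proof.
move=> lev; pose f (i : 'I_(1 + b)) : nat := bump 1 i.
have f_inj : injective f by move=> i j /(can_inj (bumpK 1))/val_inj.
pose i0 : 'I_1 := 0.
have par0 v : lcoef (param f v) 0 = v 0 (lshift b i0).
  exact: (lcoef_param_f f_inj v (lshift b i0)).
apply: (param_pt_isomorphic f_inj).
- by move=> i; rewrite lev ltz_nat /f /bump; have := ltn_ord i; lia.
- by rewrite lev; lia.
- move=> v Vv; rewrite par0; split; first exact: Vv.
  by apply: lcoef_param_notin => i; rewrite /f /bump; lia.
- move=> x [x0 [a0 b0]]; pose v : 'rV[C]_(1 + b) := \row_i lcoef x (f i).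
  have xv : ordge (level e n) (x - param f v).
    move=> q; rewrite lev => qlev; rewrite lcoefD lcoefN.
    have [q0|q0] := ltP q 0; first by rewrite x0// param_ordge// subrr.
    have [->|q1] := eqVneq q 1.
      rewrite b0 lcoef_param_notin ?subrr// => i.
      by rewrite /f /bump; lia.
    have qb : (unbump 1 (absz q) < 1 + b)%N by rewrite /unbump; lia.
    have -> : q = f (Ordinal qb) by rewrite /f /= /bump /unbump; lia.
    by rewrite (lcoef_param_f f_inj v (Ordinal qb)) mxE subrr.
  by exists v => // i; rewrite mxE (ord1 i).
- by apply: locally_closed_oh; rewrite lev; lia.
Qed.

Lemma ucell_o_split e n : 2 <= level e n ->
  ucell e n (jet (fun a b : C => a != 0)) =
    ucell e n (jet (fun a b => a != 0 /\ b != 0)) `|`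
    ucell e n (jet (fun a b => a != 0 /\ b = 0)) /\
  ucell e n (jet (fun a b : C => a != 0 /\ b != 0)) `&`
    ucell e n (jet (fun a b => a != 0 /\ b = 0)) = set0.
Proof.
move=> lev; split; apply/seteqP; split=> X //.
- move=> [x [x0 a0] <-]; have [b0|b0] := eqVneq (lcoef x 1) 0.
    by right; exists x.
  by left; exists x.
- by move=> [|] [x [x0 [a0 b0]] <-]; exists x.
- move=> [[x [x0 [a0 b0]] <-] [y [y0 [_ b1]] /wpt_umx_eq yx]].
  move/eqP: b0; apply; apply/eqP; rewrite -b1 -subr_eq0 -oppr_eq0 opprB.
  by rewrite -lcoefN -lcoefD yx//; lia.
Qed.

(** At level 1 only the constant term of the coordinate matters. *)
Lemma ucell_level1 e n : level e n = 1 ->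
  ucell e n (jet (fun a b : C => a != 0)) =
  ucell e n (jet (fun a b : C => a != 0 /\ b = 0)).
Proof.
move=> lev; apply/seteqP; split=> X; last by move=> [x [x0 [a0 _]] <-]; exists x.
move=> [x [x0 a0] <-]; exists (jet_rep (lcoef x 0) 0).
  by split; [exact: jet_rep_ordge|rewrite jet_rep0 jet_rep1].
apply/wpt_umx_eq => k; rewrite lev lcoefD lcoefN => k1.
have [k0|k0] := ltP k 0; first by rewrite x0// jet_rep_ordge// subrr.
have -> : k = 0 by lia.
by rewrite jet_rep0 subrr.
Qed.

Lemma lcell_ordeq1 e n :
  lcell e n (@ordeq R 1) = lcell e n (jet (fun a b : C => a = 0 /\ b != 0)).
Proof.
congr (lcell _ _ _); apply/seteqP; split=> x.
  by move=> [x1 b0]; split; [exact: ordgeW x1|rewrite x1].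
move=> [x0 [a0 b0]]; split=> // k k1.
have [k0|k0] := ltP k 0; first exact: x0.
by have -> : k = 0 by lia.
Qed.

End Isomorphism.

(** * Orbits and isomorphism types *)

Theorem proposition7p1 (R : realType) :
  (forall n : int, n < 0 -> is_I4_orbit (E_o R n) /\ is_I4_orbit (E_h R n)) /\
  ((forall n : int, n <= 0 -> is_I4_orbit (O_o R n)) /\
   (forall n : int, n <= -2 -> is_I4_orbit (O_h R n))) /\
  ((forall n : int, 0 < n -> is_I4_orbit (E_ho R n)) /\
   (forall n : int, 2 <= n -> is_I4_orbit (E_hh R n))) /\
  (forall n : int, 0 < n -> is_I4_orbit (O_ho R n) /\ is_I4_orbit (O_hh R n)) /\
  (forall n : int, 0 < n ->
     (E_o R n = E_oo R n `|` E_oh R n /\ E_oo R n `&` E_oh R n = set0) /\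
     (is_I4rot_orbit (E_oo R n) /\
      flag_isomorphic (E_oo R n) (Gm_affine R 2 (absz (2 * n - 2)%R))) /\
     (is_I4_orbit (E_oh R n) /\
      flag_isomorphic (E_oh R n) (Gm_affine R 1 (absz (2 * n - 2)%R)))) /\
  (forall n : int, 0 < n ->
     (O_o R n = O_oo R n `|` O_oh R n /\ O_oo R n `&` O_oh R n = set0) /\
     (is_I4rot_orbit (O_oo R n) /\
      flag_isomorphic (O_oo R n) (Gm_affine R 2 (absz (2 * n - 1)%R))) /\
     (is_I4_orbit (O_oh R n) /\
      flag_isomorphic (O_oh R n) (Gm_affine R 1 (absz (2 * n - 1)%R)))).
Proof.
have levE (n : int) : level false n = 2 * n by rewrite /level addr0.
have levO (n : int) : level true n = 2 * n + 1 by [].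
split; last split; last split; last split; last split.
- move=> n n0; split.
    rewrite /E_o n0 (_ : _ @` _ = lcell false n (@ordeq R 1)).
      by rewrite lcell_ordeq1; apply: lcell_is_I4_orbit; [rewrite levE; lia|constructor].
    rewrite -[bracket' _]/(@brk R (~~ false) _) -(@brk_ordeq _ _ _ _ (- n - 1))//.
      by rewrite levO; lia.
    by rewrite levE; lia.
  rewrite /E_h (_ : _ `|` _ = lcell false n (jet (fun a b => a = 0 /\ b = 0))).
    by apply: lcell_is_I4_orbit; [rewrite levE; lia|constructor].
  rewrite -lcell_hh levE -mulNr; congr (_ `|` _).
    apply: eq_bigcupr => k; rewrite /zrange /= => kr.
    rewrite -(@brk_ordeq _ _ _ _ (- n - 1 - k)) /=; [|rewrite levO; lia|rewrite levE; lia].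
    have -> : - n - (k + 1) = - n - 1 - k by lia.
    by [].
  by rewrite -[bracket _ _]/(brk false _ _) brk_wpt !mulr0.
- split=> n n0; last first.
    rewrite /O_h (_ : _ `|` _ = lcell true n (jet (fun a b => a = 0 /\ b = 0))).
      by apply: lcell_is_I4_orbit; [rewrite levO; lia|constructor].
    rewrite -lcell_hh levO; congr (_ `|` _).
      rewrite (_ : - (2 * n + 1) - 1 = -2 * n - 2); last by lia.
      apply: eq_bigcupr => k; rewrite /zrange /= => kr.
      rewrite -(@brk_ordeq _ _ _ _ (- n - 2 - k)) /=; [|rewrite levE; lia|rewrite levO; lia].
      have -> : - n - (k + 1) = - n - 1 - k by lia.
      by [].
    by rewrite -[bracket' _ _]/(brk true _ _) brk_wpt !mulr0.
  rewrite /O_o; case: ifPn => nlt0.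
    rewrite (_ : _ @` _ = lcell true n (@ordeq R 1)).
      by rewrite lcell_ordeq1; apply: lcell_is_I4_orbit; [rewrite levO; lia|constructor].
    rewrite -[bracket _]/(@brk R (~~ true) _) -(@brk_ordeq _ _ _ _ (- n - 2))//.
      by rewrite levE; lia.
    by rewrite levO; lia.
  rewrite -[bracket' _]/(@brk R true _) brk_o; [|rewrite levO; lia|lia].
  rewrite ucell_level1; last by rewrite levO; lia.
  by apply: ucell_is_I4_orbit; [rewrite levO; lia|constructor].
- split=> n n0.
    rewrite /E_ho -[bracket _]/(@brk R false _) brk_ho; [|rewrite levE; lia|lia].
    by apply: ucell_is_I4_orbit; [rewrite levE; lia|constructor].
  rewrite /E_hh -[bracket _]/(@brk R false _) brk_hh; [|rewrite levE; lia|lia].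
  by apply: ucell_is_I4_orbit; [rewrite levE; lia|constructor].
- move=> n n0; split.
    rewrite /O_ho -[bracket' _]/(@brk R true _) brk_ho; [|rewrite levO; lia|lia].
    by apply: ucell_is_I4_orbit; [rewrite levO; lia|constructor].
  rewrite /O_hh -[bracket' _]/(@brk R true _) brk_hh; [|rewrite levO; lia|lia].
  by apply: ucell_is_I4_orbit; [rewrite levO; lia|constructor].
- move=> n n0.
  rewrite /E_o ltNge ltW//= /E_oo /E_oh -[bracket _]/(@brk R false _).
  rewrite brk_o ?brk_oo ?brk_oh ?levE; try lia.
  have lev : level false n = (2 + absz (2 * n - 2)%R)%N by rewrite levE; lia.
  split; [|split; split].
  + by apply: ucell_o_split; rewrite levE; lia.
  + by apply: ucell_is_I4rot_orbit; rewrite levE; lia.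
  + exact: ucell_oo_isomorphic.
  + by apply: ucell_is_I4_orbit; [rewrite levE; lia|constructor].
  + exact: ucell_oh_isomorphic.
- move=> n n0.
  rewrite /O_o ltNge ltW//= /O_oo /O_oh -[bracket' _]/(@brk R true _).
  rewrite brk_o ?brk_oo ?brk_oh ?levO; try lia.
  have lev : level true n = (2 + absz (2 * n - 1)%R)%N by rewrite levO; lia.
  split; [|split; split].
  + by apply: ucell_o_split; rewrite levO; lia.
  + by apply: ucell_is_I4rot_orbit; rewrite levO; lia.
  + exact: ucell_oo_isomorphic.
  + by apply: ucell_is_I4_orbit; [rewrite levO; lia|constructor].
  + exact: ucell_oh_isomorphic.
Qed.
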